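(* Suppose that the densest $k$-subgraph problem is hard to approximate within a factor $O(n^{1/d})$ for some constant $d$. Then for any $d'>2d+1$, the $k$-forest problem in Euclidean $d'$-dimensional space is hard to approximate within a factor $O\big(n^{\frac{1}{2d}-\frac{1}{d'-1}}\big)$.
   Context: Densest $k$-subgraph: given a graph on $n$ vertices and an integer $k$, find a set of $k$ vertices maximizing the number of edges of the induced subgraph. The $k$-forest problem in Euclidean $d'$-dimensional space: given $n$ points in $\mathbb{R}^{d'}$, a set $\mathcal{D}$ of pairs of these points and an integer $k$, find a minimum total-length forest (a finite set of line segments, arbitrary Steiner points allowed) such that at least $k$ pairs of $\mathcal{D}$ have both endpoints in the same connected component. ''Hard to approximate within factor $f(n)$'' means no polynomial-time algorithm achieves approximation ratio $f(n)$. *)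

(* Defs.v *)
From HB Require Import structures.
From mathcomp Require Import all_boot all_order all_algebra.
From mathcomp Require Import all_classical all_reals all_analysis.

Set Implicit Arguments.
Unset Strict Implicit.
Unset Printing Implicit Defensive.

Import Order.TTheory GRing.Theory Num.Theory.
Import numFieldNormedType.Exports.

Local Open Scope classical_set_scope.
Local Open Scope ring_scope.

(* Polynomial time is defined with Jones' WHILE language on binary trees
   (N. D. Jones, Computability and Complexity from a Programming Perspective).
   Every assignment is charged the size of the value it stores, so all the
   trees held in memory are at most linear in the input size plus the running
   time; this makes the time measure polynomially equivalent to that of
   multi-tape Turing machines, also for functions with a structured output. *)

Inductive tree : Type := Leaf | Node of tree & tree.

Fixpoint tree_size (a : tree) : nat :=
  if a is Node l r then (tree_size l + tree_size r).+1 else 1%N.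

Inductive expr : Type :=
  | Var of nat
  | Nil
  | Cons of expr & expr
  | Hd of expr
  | Tl of expr.

Inductive cmd : Type :=
  | Assign of nat & expr
  | Seq of cmd & cmd
  | If of expr & cmd & cmd
  | While of expr & cmd.

Definition store := nat -> tree.

Definition update (s : store) (x : nat) (a : tree) : store :=
  fun y => if y == x then a else s y.

Fixpoint eval (s : store) (e : expr) : tree :=
  match e with
  | Var x => s x
  | Nil => Leaf
  | Cons e1 e2 => Node (eval s e1) (eval s e2)
  | Hd e1 => if eval s e1 is Node l _ then l else Leaf
  | Tl e1 => if eval s e1 is Node _ r then r else Leaf
  end.

Definition is_true_tree (a : tree) : bool := if a is Node _ _ then true else false.

(* [exec c s s' t]: started in store [s], the command [c] halts in store [s']
   after time [t]. *)
Inductive exec : cmd -> store -> store -> nat -> Prop :=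
  | exec_assign x e s :
      exec (Assign x e) s (update s x (eval s e)) (tree_size (eval s e)).+1
  | exec_seq c1 c2 s s' s'' t1 t2 :
      exec c1 s s' t1 -> exec c2 s' s'' t2 ->
      exec (Seq c1 c2) s s'' (t1 + t2).+1
  | exec_if_true e c1 c2 s s' t :
      is_true_tree (eval s e) -> exec c1 s s' t ->
      exec (If e c1 c2) s s' t.+1
  | exec_if_false e c1 c2 s s' t :
      ~~ is_true_tree (eval s e) -> exec c2 s s' t ->
      exec (If e c1 c2) s s' t.+1
  | exec_while_true e c s s' s'' t1 t2 :
      is_true_tree (eval s e) -> exec c s s' t1 -> exec (While e c) s' s'' t2 ->
      exec (While e c) s s'' (t1 + t2).+1
  | exec_while_false e c s :
      ~~ is_true_tree (eval s e) -> exec (While e c) s s 1.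

(* Variable 0 holds the input at the start and the output at the end. *)
Definition computes_in (c : cmd) (input output : tree) (t : nat) : Prop :=
  exists2 s', exec c (update (fun=> Leaf) 0 input) s' t & s' 0 = output.

Definition poly_time_solves (I : Type) (O : I -> Type)
    (enc_in : I -> tree) (enc_out : forall x, O x -> tree)
    (correct : forall x, O x -> Prop) (c : cmd) : Prop :=
  exists a b : nat, forall x : I, exists (y : O x) (t : nat),
    [/\ computes_in c (enc_in x) (enc_out x y) t,
        (t <= a * tree_size (enc_in x) ^ b)%N
      & correct x y].

Definition enc_bool (b : bool) : tree := if b then Node Leaf Leaf else Leaf.

Definition enc_pair (T U : Type) (encT : T -> tree) (encU : U -> tree)
  (p : T * U) : tree := Node (encT p.1) (encU p.2).

Definition enc_seq (T : Type) (enc : T -> tree) (s : seq T) : tree :=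
  foldr (fun x a => Node (enc x) a) Leaf s.

(* Binary digits, least significant first; 0 has the single digit 0. *)
Definition binary_digits (n : nat) : seq bool :=
  [seq odd (n %/ 2 ^ i)%N | i <- iota 0 (trunc_log 2 n).+1].

Definition enc_nat (n : nat) : tree := enc_seq enc_bool (binary_digits n).

Definition enc_int (z : int) : tree :=
  enc_pair enc_bool enc_nat (z < 0, `|z|%N).

Definition enc_rat (q : rat) : tree :=
  enc_pair enc_int enc_int (numq q, denq q).

Definition enc_rV (m : nat) (v : 'rV[rat]_m) : tree :=
  enc_seq enc_rat [seq v ord0 j | j <- enum 'I_m].

Definition enc_rel (n : nat) (e : rel 'I_n) : tree :=
  enc_seq (enc_seq enc_bool) [seq [seq e i j | j <- enum 'I_n] | i <- enum 'I_n].

Definition enc_set (n : nat) (A : {set 'I_n}) : tree :=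
  enc_seq enc_bool [seq i \in A | i <- enum 'I_n].

Record dks_instance : Type := DksInstance {
  dks_n : nat;
  dks_adj : rel 'I_dks_n;
  dks_k : nat;
  dks_adj_sym : symmetric dks_adj;
  dks_adj_irr : irreflexive dks_adj;
  dks_k_le : (dks_k <= dks_n)%N }.

Definition enc_dks (G : dks_instance) : tree :=
  enc_pair (@enc_rel (dks_n G)) enc_nat (@dks_adj G, dks_k G).

(* Each edge {i, j} is counted once, as the pair (i, j) with i < j. *)
Definition induced_edges (G : dks_instance) (S : {set 'I_(dks_n G)}) : nat :=
  #|[set p : 'I_(dks_n G) * 'I_(dks_n G) |
      [&& (p.1 < p.2)%N, p.1 \in S, p.2 \in S & dks_adj p.1 p.2]]|.

Definition dks_approx (R : realType) (f : nat -> R)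
    (G : dks_instance) (S : {set 'I_(dks_n G)}) : Prop :=
  #|S| = dks_k G /\
  forall T : {set 'I_(dks_n G)}, #|T| = dks_k G ->
    (induced_edges T)%:R <= f (dks_n G) * (induced_edges S)%:R.

Definition dks_hard_within (R : realType) (f : nat -> R) : Prop :=
  ~ exists c : cmd,
      poly_time_solves enc_dks (fun G => @enc_set (dks_n G)) (dks_approx f) c.

(* A finite list of segments, each given by its two endpoints, is read as the
   geometric graph whose nodes are the endpoints and whose edges are the
   segments. Nodes are arbitrary points; two segments that cross are connected
   at the crossing point only if it is made a node, which costs no length. *)
Section Segments.
Context {R : realType} {m : nat}.
Implicit Types (F : seq ('rV[R]_m * 'rV[R]_m)) (p q : 'rV[R]_m).

Definition adjacent F : rel 'rV[R]_m :=
  fun p q => ((p, q) \in F) || ((q, p) \in F).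

(* The second clause (with the first) says that every segment is listed once,
   in one orientation, and is nondegenerate; hence a [ucycle] of size 2 runs
   back and forth along one edge, and the cycles of the graph are the
   [ucycle]s of size at least 3. *)
Definition is_forest F : Prop :=
  [/\ uniq F,
      forall p q, (p, q) \in F -> (q, p) \notin F
    & forall c : seq 'rV[R]_m, ucycle (adjacent F) c -> (size c <= 2)%N].

Definition same_component F p q : Prop :=
  exists2 s : seq 'rV[R]_m, path (adjacent F) p s & last p s = q.

Definition euclidean_dist p q : R :=
  Num.sqrt (\sum_(i < m) (p ord0 i - q ord0 i) ^+ 2).

Definition total_length F : R := \sum_(s <- F) euclidean_dist s.1 s.2.

End Segments.

(* Points are rational, so that instances are finite objects. The unordered
   pair {i, j} of demands is represented by (i, j) with i < j. *)
Record kforest_instance (m : nat) : Type := KforestInstance {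
  kf_n : nat;
  kf_point : 'I_kf_n -> 'rV[rat]_m;
  kf_demands : {set 'I_kf_n * 'I_kf_n};
  kf_k : nat;
  kf_point_inj : injective kf_point;
  kf_demands_lt : forall p, p \in kf_demands -> (p.1 < p.2)%N;
  kf_k_le : (kf_k <= #|kf_demands|)%N }.

Definition enc_kforest (m : nat) (X : kforest_instance m) : tree :=
  enc_pair (enc_seq (@enc_rV m))
    (enc_pair (@enc_rel (kf_n X)) enc_nat)
    ([seq kf_point i | i <- enum 'I_(kf_n X)],
     ((fun i j => (i, j) \in kf_demands X), kf_k X)).

Definition enc_segments (m : nat) (F : seq ('rV[rat]_m * 'rV[rat]_m)) : tree :=
  enc_seq (enc_pair (@enc_rV m) (@enc_rV m)) F.

Section KForest.
Context {R : realType} {m : nat}.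

Definition real_point (v : 'rV[rat]_m) : 'rV[R]_m := map_mx ratr v.

Definition real_segments (F : seq ('rV[rat]_m * 'rV[rat]_m)) :
    seq ('rV[R]_m * 'rV[R]_m) :=
  [seq (real_point s.1, real_point s.2) | s <- F].

Definition kforest_feasible (X : kforest_instance m)
    (F : seq ('rV[R]_m * 'rV[R]_m)) : Prop :=
  is_forest F /\
  (kf_k X <= #|[set p in kf_demands X |
       `[< same_component F (real_point (kf_point p.1))
                            (real_point (kf_point p.2)) >]]|)%N.

(* The algorithm outputs a forest with rational nodes, but it is compared with
   all forests of the real space. *)
Definition kforest_approx (f : nat -> R) (X : kforest_instance m)
    (F : seq ('rV[rat]_m * 'rV[rat]_m)) : Prop :=
  kforest_feasible X (real_segments F) /\
  forall F' : seq ('rV[R]_m * 'rV[R]_m), kforest_feasible X F' ->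
    total_length (real_segments F) <= f (kf_n X) * total_length F'.

End KForest.

Definition kforest_hard_within (R : realType) (m : nat) (f : nat -> R) : Prop :=
  ~ exists c : cmd,
      poly_time_solves (@enc_kforest m) (fun=> @enc_segments m)
        (kforest_approx f) c.

(* A problem is hard within O(g) when it is hard within every factor f that
   is O(g). *)
Definition within_bigO (R : realType) (hard_within : (nat -> R) -> Prop)
    (g : nat -> R) : Prop :=
  forall f : nat -> R, f =O_\oo g -> hard_within f.

(* Main.v *)
(* The vertices of a graph with [n] vertices are placed on a [d']-dimensional
   integer grid of side about [n^(1/d')], and its edges are the demands. If some
   [k] vertices span [l] edges, a star joining them is a forest of length
   [O(k n^(1/d'))] that satisfies [l] demands. So an approximation algorithm for
   the forest problem, asked for [l] demands, returns a forest of length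
   [O(k n^(1/(2d)))]. Call a vertex linked if the forest joins it to one of its
   neighbours: there are at least [l] edges between linked vertices, and since
   distinct points are at distance at least 1, the length of the forest is at
   least half the number of linked vertices. The linked vertices can be cut into
   [r = O(n^(1/(2d)))] blocks of [k/2] vertices, and one of the [r^2] unions of
   two blocks contains at least [l/r^2] edges. Since the optimal [l] is not known,
   all its values are tried.

   The reduction is programmed as a function between encodable types. A function
   is [poly_time] if some WHILE program computes it in polynomial time as a
   subroutine; this class is closed under composition, pairing, tests and folds
   whose accumulator has polynomial size. *)
Require Import Defs.
From mathcomp Require Import all_boot all_order all_algebra.
From mathcomp Require Import all_classical all_reals all_analysis.
From mathcomp Require Import zify ring lra.
Import Order.TTheory GRing.Theory Num.Theory.
Import numFieldNormedType.Exports.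

Set Implicit Arguments.
Unset Strict Implicit.
Unset Printing Implicit Defensive.

(** The obstacle in bounding the length from below is that paths joining different linked vertices
    may share segments and run through arbitrary nodes, so a segment cannot be assigned to a single
    vertex. Each grid point therefore carries a potential of height 1/2, supported in the ball of
    radius 1/2 around it for the maximum norm. A path from a vertex to another grid point loses this
    1/2 entirely, while one segment changes all the potentials together by at most its own length.
    Blocks are combined in twos because an edge has two ends. This squares the number of blocks, and
    it is why the exponent [1/d] for graphs becomes [1/(2d)] for forests. The side of the grid costs
    a further factor [n^(1/d')], which is paid for by the term [1/(d'-1)], as this is at least
    [1/d']. Programs count in unary, so that the number of passes of a loop is bounded by the size
    of its input; binary digits occur in the codes of instances and of points. *)

(** * Codes of data and their sizes *)

Class encodable (T : Type) := encode : T -> tree.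

Definition code_size {T : Type} {eT : encodable T} (x : T) : nat :=
  tree_size (encode x).

(** Unary, so that a loop with [n] passes is polynomial in the size of the code of [n]. This is also
    the code of [nseq n false], so numbers and lists of that length are exchanged without
    computation. *)
Definition enc_unary (n : nat) : tree := iter n (Node Leaf) Leaf.

Instance encodable_bool : encodable bool := enc_bool.
Instance encodable_nat : encodable nat := enc_unary.
Instance encodable_prod (T U : Type) (eT : encodable T) (eU : encodable U) :
  encodable (T * U) := enc_pair eT eU.
Instance encodable_seq (T : Type) (eT : encodable T) : encodable (seq T) :=
  enc_seq eT.
Instance encodable_dks : encodable dks_instance := enc_dks.
Instance encodable_kforest (m : nat) : encodable (kforest_instance m) :=
  @enc_kforest m.

Lemma tree_size_gt0 a : 0 < tree_size a.
Proof. by case: a. Qed.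

Lemma code_size_gt0 T {eT : encodable T} (x : T) : 0 < code_size x.
Proof. exact: tree_size_gt0. Qed.

Lemma code_size_pair T U {eT : encodable T} {eU : encodable U} (p : T * U) :
  code_size p = (code_size p.1 + code_size p.2).+1.
Proof. by []. Qed.

Lemma code_size_cons T {eT : encodable T} (x : T) s :
  code_size (x :: s) = (code_size x + code_size s).+1.
Proof. by []. Qed.

Lemma code_size_nil T {eT : encodable T} : code_size (@nil T) = 1.
Proof. by []. Qed.

Lemma code_size_nat (n : nat) : code_size n = n.*2.+1.
Proof.
rewrite /code_size /encode /encodable_nat; elim: n => //= n ->; lia.
Qed.

Lemma code_size_bool (b : bool) : code_size b <= 3.
Proof. by case: b. Qed.

Lemma leq_size_code_size T {eT : encodable T} (s : seq T) : size s <= code_size s.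
Proof.
elim: s => //= x s IH; rewrite code_size_cons; lia.
Qed.

Lemma code_size_mem (T : eqType) {eT : encodable T} (x : T) s :
  x \in s -> code_size x <= code_size s.
Proof.
elim: s => //= y s IH; rewrite inE code_size_cons => /predU1P[->|/IH]; lia.
Qed.

Lemma code_size_drop T {eT : encodable T} n (s : seq T) :
  code_size (drop n s) <= code_size s.
Proof.
elim: s n => [|x s IH] [|n] //=; rewrite code_size_cons.
by apply: leq_trans (IH n) _; lia.
Qed.

Lemma code_size_le T {eT : encodable T} B (s : seq T) :
  (forall n, n < size s -> forall x0, code_size (nth x0 s n) <= B) ->
  code_size s <= (size s * B.+1).+1.
Proof.
elim: s => [|x s IH] //= Hs; rewrite code_size_cons.
have := Hs 0 isT x => /= Hx.
have /IH : forall n, n < size s -> forall x0, code_size (nth x0 s n) <= B.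
  by move=> n Hn x0; apply: (Hs n.+1 _ x0).
lia.
Qed.

(** * Polynomially bounded functions *)

Definition poly_bounded {T : Type} {eT : encodable T} (g : T -> nat) : Prop :=
  exists a b, forall x, g x <= a * code_size x ^ b.

Section PolyBounded.
Context {T : Type} {eT : encodable T}.
Implicit Types g h : T -> nat.

Lemma poly_bounded_le g h :
  poly_bounded h -> (forall x, g x <= h x) -> poly_bounded g.
Proof. by move=> [a [b H]] gh; exists a, b => x; apply: leq_trans (gh x) _. Qed.

Lemma poly_bounded_const k : poly_bounded (fun _ : T => k).
Proof. by exists k, 0 => x; rewrite expn0 muln1. Qed.

Lemma poly_bounded_size : poly_bounded (fun x : T => code_size x).
Proof. by exists 1, 1 => x; rewrite expn1 mul1n. Qed.

Lemma poly_bounded_add g h :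
  poly_bounded g -> poly_bounded h -> poly_bounded (fun x => g x + h x).
Proof.
move=> [a [b Hg]] [a' [b' Hh]]; exists (a + a'), (b + b') => x.
have p k : 0 < code_size x ^ k by rewrite expn_gt0 code_size_gt0.
rewrite mulnDl expnD; apply: leq_add.
  by apply: leq_trans (Hg x) _; rewrite leq_mul2l leq_pmulr ?orbT.
by apply: leq_trans (Hh x) _; rewrite leq_mul2l leq_pmull ?orbT.
Qed.

Lemma poly_bounded_mul g h :
  poly_bounded g -> poly_bounded h -> poly_bounded (fun x => g x * h x).
Proof.
move=> [a [b Hg]] [a' [b' Hh]]; exists (a * a'), (b + b') => x.
by rewrite expnD mulnACA leq_mul.
Qed.

Lemma poly_bounded_exp g k :
  poly_bounded g -> poly_bounded (fun x => g x ^ k).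
Proof.
move=> Hg; elim: k => [|k IH]; first exact: poly_bounded_const.
apply: poly_bounded_le (poly_bounded_mul Hg IH) _ => x; by rewrite expnS.
Qed.

Lemma poly_bounded_succ g : poly_bounded g -> poly_bounded (fun x => (g x).+1).
Proof.
move=> Hg; apply: poly_bounded_le (poly_bounded_add Hg (poly_bounded_const 1)) _ => x.
by rewrite addn1.
Qed.

Lemma poly_bounded_comp U (eU : encodable U) (f : T -> U) (g : U -> nat) :
  poly_bounded (fun x => code_size (f x)) -> poly_bounded g ->
  poly_bounded (fun x => g (f x)).
Proof.
move=> Hf [a [b Hg]].
apply: poly_bounded_le
  (poly_bounded_mul (poly_bounded_const a) (poly_bounded_exp b Hf)) _ => x.
exact: Hg.
Qed.

End PolyBounded.

(** * Functions computable in polynomial time *)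

(* The command may be started in any store, and leaves the variables from
   [m] on untouched; this makes it usable as a subroutine. *)
Definition poly_time {A B : Type} {eA : encodable A} {eB : encodable B}
    (f : A -> B) : Prop :=
  exists (c : cmd) (m : nat) (time : A -> nat), poly_bounded time /\
    forall x (s : store), s 0 = encode x -> exists s' t,
      [/\ exec c s s' t, s' 0 = encode (f x), t <= time x
        & forall y, m <= y -> s' y = s y].

(** An assignment is charged the size of the stored value, so nothing outgrows its old size plus the
    elapsed time. Hence polynomial-time functions have outputs of polynomial size, which makes them
    composable. *)
Lemma exec_size c s s' t : exec c s s' t ->
  forall y, tree_size (s' y) <= tree_size (s y) + t.
Proof.
elim=> {c s s' t}
  [x e s|c1 c2 s s' s'' t1 t2 _ H1 _ H2|e c1 c2 s s' t _ _ H|e c1 c2 s s' t _ _ H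
  |e c s s' s'' t1 t2 _ _ H1 _ H2|e c s _] y.
- rewrite /update; case: ifP => _; lia.
- have := H1 y; have := H2 y; lia.
- have := H y; lia.
- have := H y; lia.
- have := H1 y; have := H2 y; lia.
- lia.
Qed.

Lemma poly_time_size A B (eA : encodable A) (eB : encodable B) (f : A -> B) :
  poly_time f -> poly_bounded (fun x => code_size (f x)).
Proof.
move=> [c [m [time [Ht H]]]].
apply: poly_bounded_le (poly_bounded_add poly_bounded_size Ht) _ => x.
have [s' [t [/exec_size/(_ 0) He s'0 tt _]]] := H x (fun=> encode x) erefl.
rewrite /code_size -s'0; apply: leq_trans He _.
by rewrite leq_add2l.
Qed.

Ltac poly_bound := repeat first
  [ assumption | exact: poly_bounded_const | exact: poly_bounded_size
  | (apply: poly_time_size; assumption) | apply: poly_bounded_succ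
  | apply: poly_bounded_add | apply: poly_bounded_mul | apply: poly_bounded_exp ].

Lemma poly_time_ext A B (eA : encodable A) (eB : encodable B) (f g : A -> B) :
  poly_time f -> f =1 g -> poly_time g.
Proof.
move=> [c [m [time [Ht H]]]] fg; exists c, m, time; split=> // x s s0.
by rewrite -fg; exact: H.
Qed.

(** A program sees only codes. Passing to another type with the same codes, such as from a pair to a
    list cell or from bit lists to rational vectors, therefore takes no work. *)
Lemma poly_time_encode A B C (eA : encodable A) (eB : encodable B)
    (eC : encodable C) (f : A -> B) (g : A -> C) :
  poly_time f -> (forall x, encode (f x) = encode (g x)) -> poly_time g.
Proof.
move=> [c [m [time [Ht H]]]] fg; exists c, m, time; split=> // x s s0.
by rewrite -fg; exact: H.
Qed.

Fixpoint expr_size (e : expr) : nat :=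
  match e with
  | Var _ | Defs.Nil => 1
  | Defs.Cons e1 e2 => (expr_size e1 + expr_size e2).+1
  | Hd e1 | Tl e1 => (expr_size e1).+1
  end.

Lemma tree_size_eval e a :
  tree_size (Defs.eval (fun=> a) e) <= expr_size e * tree_size a.
Proof.
have a0 := tree_size_gt0 a.
elim: e => [n||e1 H1 e2 H2|e H|e H] /=; try nia.
- move: H; case: (Defs.eval _ e) => /= [|l r]; nia.
- move: H; case: (Defs.eval _ e) => /= [|l r]; nia.
Qed.

Lemma poly_time_expr A B (eA : encodable A) (eB : encodable B) (f : A -> B) e :
  (forall x s, s 0 = encode x -> Defs.eval s e = encode (f x)) -> poly_time f.
Proof.
move=> H; exists (Assign 0 e), 1, (fun x => (expr_size e * code_size x).+1).
split.
  apply: poly_bounded_succ; apply: poly_bounded_mul.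
    exact: poly_bounded_const.
  exact: poly_bounded_size.
move=> x s s0; eexists; eexists; split; first exact: exec_assign.
- by rewrite /update eqxx; exact: H.
(* By the hypothesis on [e], its value is the same in the constant store [fun=> encode x], where
   [tree_size_eval] bounds it. *)
- by rewrite ltnS (H _ _ s0) -(H x (fun=> encode x) erefl) tree_size_eval.
- by move=> [].
Qed.

Section Composition.
Context {A B C : Type} {eA : encodable A} {eB : encodable B} {eC : encodable C}.

Lemma poly_time_comp (f : A -> B) (g : B -> C) :
  poly_time g -> poly_time f -> poly_time (fun x => g (f x)).
Proof.
move=> [cg [mg [tg [Pg Hg]]]] Pf'; have := Pf'.
move=> [cf [mf [tf [Pf Hf]]]].
exists (Seq cf cg), (maxn mf mg), (fun x => (tf x + tg (f x)).+1); split.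
  apply/poly_bounded_succ/poly_bounded_add => //.
  exact: poly_bounded_comp (poly_time_size Pf') Pg.
move=> x s s0.
have [s1 [t1 [E1 O1 T1 F1]]] := Hf x s s0.
have [s2 [t2 [E2 O2 T2 F2]]] := Hg _ s1 O1.
exists s2, (t1 + t2).+1; split => //; first exact: exec_seq E1 E2.
  by rewrite ltnS leq_add.
by move=> y; rewrite geq_max => /andP[y1 y2]; rewrite F2 // F1.
Qed.

Lemma poly_time_pair (f : A -> B) (g : A -> C) :
  poly_time f -> poly_time g -> poly_time (fun x => (f x, g x)).
Proof.
move=> Pf' Pg'; have := Pf'; have := Pg'.
move=> [cg [mg [tg [Pg Hg]]]] [cf [mf [tf [Pf Hf]]]].
(* Both commands leave the variables from [m] on untouched: [m] saves the input and [m.+1] the first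
   result. *)
pose m := (maxn mf mg).+1.
have m0 : (m == 0) = false by rewrite /m.
have mm : (m.+1 == m) = false by lia.
have mm' : (m == m.+1) = false by lia.
exists (Seq (Assign m (Var 0)) (Seq cf (Seq (Assign m.+1 (Var 0))
  (Seq (Assign 0 (Var m)) (Seq cg (Assign 0 (Defs.Cons (Var m.+1) (Var 0)))))))), m.+2,
  (fun x => 10 + (2 * code_size x + 2 * code_size (f x) + code_size (g x) + tf x + tg x)).
split.
  apply: poly_bounded_add; first exact: poly_bounded_const.
  apply: poly_bounded_add => //; apply: poly_bounded_add => //.
  apply: poly_bounded_add; last exact: poly_time_size.
  apply: poly_bounded_add; (apply: poly_bounded_mul; first exact: poly_bounded_const).
    exact: poly_bounded_size.
  exact: poly_time_size.
move=> x s s0.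
have [|s1 [t1 [E1 O1 T1 F1]]] := Hf x (update s m (s 0)); first by rewrite /update eq_sym m0.
set s2 := update (update s1 m.+1 (s1 0)) 0 (s1 m).
have F1m : s1 m = encode x by rewrite F1 /update ?eqxx // /m; lia.
have [|s3 [t3 [E3 O3 T3 F3]]] := Hg x s2; first by rewrite /s2 /update eqxx.
eexists; eexists; split.
- apply: exec_seq; first exact: exec_assign.
  apply: exec_seq; first exact: E1.
  apply: exec_seq; first exact: exec_assign.
  apply: exec_seq; first exact: exec_assign.
  apply: exec_seq; last exact: exec_assign.
  by rewrite /= [X in update _ 0 X]/update mm'; exact: E3.
- rewrite /update /= O3 F3; last by rewrite /m; lia.
  by rewrite /s2 /update /= eqxx O1.
- rewrite /= !O3 (F3 m.+1); last by rewrite /m; lia.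
  rewrite /s2 /update /= eqxx mm' O1 s0 F1m -/(code_size x) -/(code_size (f x)) -/(code_size (g x)).
  lia.
- move=> y ym; rewrite /update /=.
  have y0 : (y == 0) = false by lia.
  have y1 : (y == m) = false by lia.
  have y2 : (y == m.+1) = false by lia.
  rewrite y0 F3; last by lia.
  rewrite /s2 /update y0 y2 F1; last by lia.
  by rewrite /update y1.
Qed.

End Composition.

Lemma leq_expn a b n : a <= b -> a ^ n <= b ^ n.
Proof. by case: n => // n; rewrite leq_exp2r. Qed.

(** Testing the shape of a code covers several cases at once: [false], the empty list and zero are
    all coded by [Leaf]. *)
Lemma poly_time_test A B C (eA : encodable A) (eB : encodable B)
    (eC : encodable C) (b : A -> C) (f g : A -> B) :
  poly_time b -> poly_time f -> poly_time g ->
  poly_time (fun x => if is_true_tree (encode (b x)) then f x else g x).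
Proof.
move=> Pb'; have := Pb'; move=> [cb [mb [tb [Pb Hb]]]] [cf [mf [tf [Pf Hf]]]] [cg [mg [tg [Pg Hg]]]].
pose m := (maxn mb (maxn mf mg)).+1.
have m0 : (m == 0) = false by rewrite /m.
exists (Seq (Assign m (Var 0)) (Seq cb (Seq (Assign m.+1 (Var 0))
  (Seq (Assign 0 (Var m)) (If (Var m.+1) cf cg))))), m.+2,
  (fun x => 20 + (2 * code_size x + code_size (b x) + tb x + tf x + tg x)).
split.
  apply: poly_bounded_add; first exact: poly_bounded_const.
  do 4! apply: poly_bounded_add => //; last exact: poly_time_size.
  apply: poly_bounded_mul; first exact: poly_bounded_const.
  exact: poly_bounded_size.
move=> x s s0.
have [|s1 [t1 [E1 O1 T1 F1]]] := Hb x (update s m (s 0)); first by rewrite /update eq_sym m0.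
have F1m : s1 m = encode x by rewrite F1 /update ?eqxx // /m; lia.
set s2 := update (update s1 m.+1 (s1 0)) 0 (s1 m).
have mm : (m.+1 == m) = false by lia.
have mm' : (m == m.+1) = false by lia.
have [|sf [t3 [E3 O3 T3 F3]]] := Hf x s2; first by rewrite /s2 /update eqxx.
have [|sg [t4 [E4 O4 T4 F4]]] := Hg x s2; first by rewrite /s2 /update eqxx.
have A1 : exec (Assign m.+1 (Var 0)) s1 (update s1 m.+1 (s1 0)) (code_size (b x)).+1.
  by rewrite /code_size -O1; exact: (exec_assign m.+1 (Var 0) s1).
have A2 : exec (Assign 0 (Var m)) (update s1 m.+1 (s1 0)) s2 (code_size x).+1.
  have F1m' : s1 m = update s1 m.+1 (s1 0) m by rewrite /update mm'.
  rewrite /code_size -F1m /s2 F1m'.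
  exact: (exec_assign 0 (Var m) (update s1 m.+1 (s1 0))).
have s2m : s2 m.+1 = encode (b x) by rewrite /s2 /update /= eqxx O1.
have frame s3 : (forall y, m <= y -> s3 y = s2 y) ->
   forall y, m.+2 <= y -> s3 y = s y.
  move=> F y ym; rewrite F; last by lia.
  have y0 : (y == 0) = false by lia.
  have y1 : (y == m) = false by lia.
  have y2 : (y == m.+1) = false by lia.
  rewrite /s2 /update y0 y2 F1; last by lia.
  by rewrite /update y1.
have ass : exec (Assign m (Var 0)) s (update s m (s 0)) (code_size x).+1.
  by rewrite /code_size -s0; exact: (exec_assign m (Var 0) s).
case bx: (is_true_tree (encode (b x))).
- exists sf; eexists; split; [|exact: O3| |].
  + apply: exec_seq; first exact: ass.
    apply: exec_seq; first exact: E1.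
    apply: exec_seq; first exact: A1.
    apply: exec_seq; first exact: A2.
    by apply: exec_if_true; [rewrite /= s2m bx|exact: E3].
  + lia.
  + by apply: frame => y ym; apply: F3; lia.
- exists sg; eexists; split; [|exact: O4| |].
  + apply: exec_seq; first exact: ass.
    apply: exec_seq; first exact: E1.
    apply: exec_seq; first exact: A1.
    apply: exec_seq; first exact: A2.
    by apply: exec_if_false; [rewrite /= s2m bx|exact: E4].
  + lia.
  + by apply: frame => y ym; apply: F4; lia.
Qed.

Lemma poly_time_if A B (eA : encodable A) (eB : encodable B)
    (b : A -> bool) (f g : A -> B) :
  poly_time b -> poly_time f -> poly_time g ->
  poly_time (fun x => if b x then f x else g x).
Proof.
move=> Pb Pf Pg; apply: (poly_time_ext (poly_time_test Pb Pf Pg)) => x.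
by case: (b x).
Qed.

Lemma code_size_nth T {eT : encodable T} x0 (s : seq T) n :
  n < size s -> code_size (nth x0 s n) <= code_size s.
Proof.
elim: s n => // x s IH [|n] /= ns; rewrite code_size_cons; first by lia.
by have := IH n ns; lia.
Qed.

(** The bound [q] on every intermediate accumulator does not follow from the other hypotheses: a
    step that doubles the accumulator is polynomial, but its iteration is exponential. *)
Lemma poly_time_foldl A B E (eA : encodable A) (eB : encodable B)
    (eE : encodable E) (h : A -> B -> E -> B) (i : A -> B) (l : A -> seq E)
    (q : A -> nat) :
  poly_time (fun p : A * B * E => h p.1.1 p.1.2 p.2) ->
  poly_time i -> poly_time l -> poly_bounded q ->
  (forall a n, code_size (foldl (h a) (i a) (take n (l a))) <= q a) ->
  poly_time (fun a => foldl (h a) (i a) (l a)).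
Proof.
move=> [ch [mh [th [[al [be Ph]] Hh]]]] Pi' Pl' Pq Hq; have := Pl'; have := Pi'.
move=> [ci [mi [ti [Pi Hi]]]] [cl [ml [tl [Pl Hl]]]].
pose m := (maxn mh (maxn mi ml)).+1.
(* Variable [m] holds the argument, [m.+1] the rest of the list and [m.+2] the accumulator. *)
pose body := Seq (Assign 0 (Defs.Cons (Defs.Cons (Var m) (Var m.+2)) (Hd (Var m.+1))))
  (Seq (Assign m.+1 (Tl (Var m.+1))) (Seq ch (Assign m.+2 (Var 0)))).
(* [Q a] bounds the input [(a, b, e)] of every call of the step function, so that [T a] bounds the
   time of one pass. *)
pose (Q := fun a : A => code_size a + q a + code_size (l a) + 2).
pose (T := fun a : A => 10 + (2 * Q a + al * Q a ^ be + q a)).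
have PQ : poly_bounded Q.
  apply: poly_bounded_add; last exact: poly_bounded_const.
  apply: poly_bounded_add; last exact: poly_time_size.
  apply: poly_bounded_add => //; exact: poly_bounded_size.
have m0 : (m == 0) = false by rewrite /m.
have m1 : (m.+1 == m) = false by lia.
have m1' : (m == m.+1) = false by lia.
have m2 : (m.+2 == m) = false by lia.
have m2' : (m == m.+2) = false by lia.
have m3 : (m.+2 == m.+1) = false by lia.
have m3' : (m.+1 == m.+2) = false by lia.
have loop a : forall l' b s, s m = encode a -> s m.+1 = encode l' ->
    s m.+2 = encode b -> code_size l' <= code_size (l a) ->
    (forall n, code_size (foldl (h a) b (take n l')) <= q a) ->
  exists s' t, [/\ exec (While (Var m.+1) body) s s' t,
    s' m.+2 = encode (foldl (h a) b l'), t <= size l' * T a + 1 &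
    forall y, m.+3 <= y -> s' y = s y].
  elim=> [|e l' IH] b s sm sm1 sm2 sl' sb.
    exists s, 1; split => //.
    by apply: exec_while_false; rewrite /= sm1.
  set s1 := update s 0 (encode (a, b, e)).
  set s2 := update s1 m.+1 (encode l').
  have [|s3 [t3 [E3 O3 T3 F3]]] := Hh (a, b, e) s2; first by [].
  set s4 := update s3 m.+2 (s3 0).
  rewrite code_size_cons in sl'.
  have [||||n|s5 [t5 [E5 O5 T5 F5]]] := IH (h a b e) s4.
  - rewrite /s4 /update m2' F3; last by rewrite /m; lia.
    by rewrite /s2 /update m1' /s1 /update m0.
  - rewrite /s4 /update m3' F3; last by rewrite /m; lia.
    by rewrite /s2 /update eqxx.
  - by rewrite /s4 /update eqxx O3.
  - lia.
  - exact: (sb n.+1).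
  have A1 : exec (Assign 0 (Defs.Cons (Defs.Cons (Var m) (Var m.+2)) (Hd (Var m.+1)))) s s1
      (code_size (a, b, e)).+1.
    rewrite /s1 /code_size.
    have -> : encode (a, b, e) =
      Defs.eval s (Defs.Cons (Defs.Cons (Var m) (Var m.+2)) (Hd (Var m.+1))).
      by rewrite /= sm sm1 sm2.
    exact: exec_assign.
  have A2 : exec (Assign m.+1 (Tl (Var m.+1))) s1 s2 (code_size l').+1.
    rewrite /s2 /code_size.
    have -> : encode l' = Defs.eval s1 (Tl (Var m.+1)).
      by rewrite /= /s1 /update /= sm1.
    exact: exec_assign.
  have A4 : exec (Assign m.+2 (Var 0)) s3 s4 (code_size (h a b e)).+1.
    by rewrite /s4 /code_size -O3; exact: (exec_assign m.+2 (Var 0) s3).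
  exists s5; eexists; split.
  - apply: exec_while_true; [by rewrite /= sm1| |exact: E5].
    exact: exec_seq A1 (exec_seq A2 (exec_seq E3 A4)).
  - exact: O5.
  - have qb := sb 0; have qh := sb 1; rewrite /= take0 /= in qb qh.
    have t3Q : t3 <= al * Q a ^ be.
      apply: leq_trans T3 _; apply: leq_trans (Ph _) _.
      rewrite leq_mul2l leq_expn ?orbT // /Q !code_size_pair /=; lia.
    have -> : size (e :: l') = (size l').+1 by [].
    have -> : code_size (a, b, e) = (code_size a + code_size b + code_size e).+2 by [].
    by rewrite mulSn {1}/T {1}/Q; lia.
  - move=> y ym; rewrite F5 // /s4 /update.
    have y0 : (y == 0) = false by lia.
    have y1 : (y == m.+1) = false by lia.
    have y2 : (y == m.+2) = false by lia.
    rewrite y2 F3; last by lia.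
    by rewrite /s2 /update y1 /s1 /update y0.
exists (Seq (Assign m (Var 0)) (Seq ci (Seq (Assign m.+2 (Var 0))
  (Seq (Assign 0 (Var m)) (Seq cl (Seq (Assign m.+1 (Var 0))
  (Seq (While (Var m.+1) body) (Assign 0 (Var m.+2))))))))), m.+3,
  (fun a => 20 + (2 * code_size a + ti a + tl a + code_size (i a)
     + code_size (l a) + code_size (l a) * T a + q a)).
split.
  poly_bound.
move=> a s s0.
set s1 := update s m (encode a).
have A1 : exec (Assign m (Var 0)) s s1 (code_size a).+1.
  by rewrite /s1 /code_size -s0; exact: (exec_assign m (Var 0) s).
have [|s2 [t2 [E2 O2 T2 F2]]] := Hi a s1; first by rewrite /s1 /update eq_sym m0.
set s3 := update s2 m.+2 (encode (i a)).
have A3 : exec (Assign m.+2 (Var 0)) s2 s3 (code_size (i a)).+1.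
  by rewrite /s3 /code_size -O2; exact: (exec_assign m.+2 (Var 0) s2).
set s4 := update s3 0 (encode a).
have s3m : s3 m = encode a.
  rewrite /s3 /update m2' F2; last by rewrite /m; lia.
  by rewrite /s1 /update eqxx.
have A4 : exec (Assign 0 (Var m)) s3 s4 (code_size a).+1.
  by rewrite /s4 /code_size -s3m; exact: (exec_assign 0 (Var m) s3).
have [|s5 [t5 [E5 O5 T5 F5]]] := Hl a s4; first by [].
set s6 := update s5 m.+1 (encode (l a)).
have A6 : exec (Assign m.+1 (Var 0)) s5 s6 (code_size (l a)).+1.
  by rewrite /s6 /code_size -O5; exact: (exec_assign m.+1 (Var 0) s5).
have [||||//|s7 [t7 [E7 O7 T7 F7]]] := loop a (l a) (i a) s6.
- rewrite /s6 /update m1' F5; last by rewrite /m; lia.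
  by rewrite /s4 /update m0.
- by rewrite /s6 /update eqxx.
- rewrite /s6 /update m3 F5; last by rewrite /m; lia.
  by rewrite /s4 /update /= /s3 /update eqxx.
- by [].
have A8 : exec (Assign 0 (Var m.+2)) s7 (update s7 0 (s7 m.+2))
    (code_size (foldl (h a) (i a) (l a))).+1.
  by rewrite /code_size -O7; exact: (exec_assign 0 (Var m.+2) s7).
eexists; eexists; split.
- exact: (exec_seq A1 (exec_seq E2 (exec_seq A3 (exec_seq A4 (exec_seq E5
    (exec_seq A6 (exec_seq E7 A8))))))).
- by rewrite /update eqxx.
- have := Hq a (size (l a)); rewrite take_size => qa.
  have : size (l a) * T a <= code_size (l a) * T a.
    by rewrite leq_mul2r leq_size_code_size orbT.
  lia.
- move=> y ym.
  have y0 : (y == 0) = false by lia.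
  have y1 : (y == m.+1) = false by lia.
  have y2 : (y == m.+2) = false by lia.
  have y3 : (y == m) = false by lia.
  rewrite /update y0 F7 // /s6 /update y1 F5; last by lia.
  rewrite /s4 /update y0 /s3 /update y2 F2; last by lia.
  by rewrite /s1 /update y3.
Qed.

(** * Running a solver as a subroutine *)

Fixpoint expr_bound (e : expr) : nat :=
  match e with
  | Var x => x.+1
  | Defs.Nil => 0
  | Defs.Cons e1 e2 => maxn (expr_bound e1) (expr_bound e2)
  | Hd e1 | Tl e1 => expr_bound e1
  end.

Fixpoint cmd_bound (c : cmd) : nat :=
  match c with
  | Assign x e => maxn x.+1 (expr_bound e)
  | Seq c1 c2 => maxn (cmd_bound c1) (cmd_bound c2)
  | If e c1 c2 => maxn (expr_bound e) (maxn (cmd_bound c1) (cmd_bound c2))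
  | While e c1 => maxn (expr_bound e) (cmd_bound c1)
  end.

Lemma eval_bound m e (s r : store) :
  (forall y, y < m -> r y = s y) -> expr_bound e <= m ->
  Defs.eval r e = Defs.eval s e.
Proof.
move=> rs; elim: e => /= [x|//|e1 H1 e2 H2|e H /H-> //|e H /H-> //].
  exact: rs.
by rewrite geq_max => /andP[/H1-> /H2->].
Qed.

Lemma exec_frame m c s s' t : exec c s s' t -> cmd_bound c <= m ->
  forall r, (forall y, y < m -> r y = s y) -> exists r',
  [/\ exec c r r' t, forall y, y < m -> r' y = s' y
    & forall y, m <= y -> r' y = r y].
Proof.
elim=> {c s s' t}
  [x e s|c1 c2 s s' s'' t1 t2 _ H1 _ H2|e c1 c2 s s' t et _ H|e c1 c2 s s' t et _ H
  |e c s s' s'' t1 t2 et _ H1 _ H2|e c s et] /=; rewrite ?geq_max.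
- move=> /andP[xm em] r rs; exists (update r x (Defs.eval s e)); split.
  + by rewrite -(eval_bound rs em); exact: exec_assign.
  + by move=> y /rs; rewrite /update; case: eqP.
  + by move=> y ym; rewrite /update; case: eqP => // yx; lia.
- move=> /andP[b1 b2] r rs.
  have [r1 [E1 e1 F1]] := H1 b1 r rs; have [r2 [E2 e2 F2]] := H2 b2 r1 e1.
  exists r2; split=> //; first exact: exec_seq E1 E2.
  by move=> y ym; rewrite F2 ?F1.
- move=> /and3P[em b1 b2] r rs; have [r1 [E1 e1 F1]] := H b1 r rs.
  by exists r1; split=> //; apply: exec_if_true => //; rewrite (eval_bound rs).
- move=> /and3P[em b1 b2] r rs; have [r1 [E1 e1 F1]] := H b2 r rs.
  by exists r1; split=> //; apply: exec_if_false => //; rewrite (eval_bound rs).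
- move=> /andP[em b1] r rs.
  have [r1 [E1 e1 F1]] := H1 b1 r rs.
  have [|r2 [E2 e2 F2]] := H2 _ r1 e1; first by rewrite geq_max em.
  exists r2; split=> //; last by move=> y ym; rewrite F2 ?F1.
  by apply: exec_while_true E1 E2; rewrite (eval_bound rs).
- move=> /andP[em b1] r rs; exists r; split => //.
  by apply: exec_while_false; rewrite (eval_bound rs).
Qed.

(** A solver may rely on every variable except 0 being [Leaf] at the start; a subroutine finds
    leftovers there and has to erase them. *)
Fixpoint clear_then (m : nat) (c : cmd) : cmd :=
  if m is k.+1 then Seq (Assign k.+1 Defs.Nil) (clear_then k c) else c.

Lemma exec_clear_then m c s s' t :
  exec c (fun y => if 0 < y <= m then Leaf else s y) s' t ->
  exec (clear_then m c) s s' (m * 3 + t).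
Proof.
elim: m s => [|m IH] s E /=.
  by move: E; congr exec; apply/funext => -[|y].
have A : exec (Assign m.+1 Defs.Nil) s (update s m.+1 Leaf) 2.
  exact: (exec_assign m.+1 Defs.Nil s).
have /(exec_seq A) : exec (clear_then m c) (update s m.+1 Leaf) s' (m * 3 + t).
  apply: IH; move: E; congr exec; apply/funext => y; rewrite /update.
  case: (eqVneq y m.+1) => [->|ne]; first by rewrite leqnn ltnn.
  by rewrite [y <= m.+1]leq_eqVlt (negbTE ne) ltnS.
by congr exec; lia.
Qed.

(** The definition of a solver only asserts that each instance has a correct output; the choice
    principle collects these outputs into a function, which can then enter compositions. *)
Lemma poly_time_solvesP (I O : Type) (eI : encodable I) (eO : encodable O)
    (correct : I -> O -> Prop) c :
  poly_time_solves eI (fun=> eO) correct c ->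
  exists2 f : I -> O, poly_time f & forall x, correct x (f x).
Proof.
move=> [a [b H]].
have [f Hf] := choice H.
exists f; last by move=> x; have [t []] := Hf x.
pose m := (cmd_bound c).
exists (clear_then m c), m.+1, (fun x => m * 3 + a * code_size x ^ b); split.
  apply: poly_bounded_add; first exact: poly_bounded_const.
  by exists a, b.
move=> x s s0; have [t [[s' E s'0] T _]] := Hf x.
(* The store after clearing, which agrees with the initial store of the solver on all variables up
   to [m]. *)
pose r y := if 0 < y <= m then Leaf else s y.
have [||r' [E' e' F']] := @exec_frame m.+1 _ _ _ _ E _ r.
- exact: leqnSn.
- by move=> [|y] ym; rewrite /r /update ?s0 //=; case: ifP => //; lia.
exists r', (m * 3 + t); split.
- exact: exec_clear_then.
- by rewrite e'.
- by rewrite leq_add2l.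
- by move=> y ym; rewrite F' // /r; case: ifP => //; lia.
Qed.

(** * Closure properties: data structures, loops and unary arithmetic *)

Instance encodable_tree : encodable tree := id.

Fixpoint quote (a : tree) : expr :=
  if a is Node l r then Defs.Cons (quote l) (quote r) else Defs.Nil.

Lemma eval_quote s a : Defs.eval s (quote a) = a.
Proof. by elim: a => //= l -> r ->. Qed.

Section Basic.
Context {A : Type} {eA : encodable A}.

Lemma poly_time_id : poly_time (fun x : A => x).
Proof. by apply: (@poly_time_expr _ _ _ _ _ (Var 0)). Qed.

Lemma poly_time_const B (eB : encodable B) (y : B) : poly_time (fun _ : A => y).
Proof.
by apply: (@poly_time_expr _ _ _ _ _ (quote (encode y))) => x s _; rewrite eval_quote.
Qed.
#[local] Arguments poly_time_const {B eB} y.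

Lemma poly_time_fst B C (eB : encodable B) (eC : encodable C) (f : A -> B * C) :
  poly_time f -> poly_time (fun x => (f x).1).
Proof.
apply: poly_time_comp; apply: (@poly_time_expr _ _ _ _ _ (Hd (Var 0))).
by move=> x s /= ->.
Qed.

Lemma poly_time_snd B C (eB : encodable B) (eC : encodable C) (f : A -> B * C) :
  poly_time f -> poly_time (fun x => (f x).2).
Proof.
apply: poly_time_comp; apply: (@poly_time_expr _ _ _ _ _ (Tl (Var 0))).
by move=> x s /= ->.
Qed.

Lemma poly_time_cons T (eT : encodable T) (u : A -> T) (s : A -> seq T) :
  poly_time u -> poly_time s -> poly_time (fun x => u x :: s x).
Proof. by move=> Pu Ps; apply: (poly_time_encode (poly_time_pair Pu Ps)). Qed.

Lemma poly_time_behead T (eT : encodable T) (s : A -> seq T) :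
  poly_time s -> poly_time (fun x => behead (s x)).
Proof.
apply: poly_time_comp; apply: (@poly_time_expr _ _ _ _ _ (Tl (Var 0))).
by move=> [|e x] r /= ->.
Qed.

Lemma poly_time_head T (eT : encodable T) (u : A -> T) (s : A -> seq T) :
  poly_time u -> poly_time s -> poly_time (fun x => head (u x) (s x)).
Proof.
move=> Pu Ps.
(* The head is first taken as a raw tree: on an empty list it is [Leaf], which need not be the code
   of an element of [T]. *)
have Ph : poly_time (fun x => if encode (s x) is Node l _ then l else Leaf).
  apply: (poly_time_comp (g := fun t => if encode t is Node l _ then l else Leaf)) Ps.
  by apply: (@poly_time_expr _ _ _ _ _ (Hd (Var 0))) => x r /= ->.
have Pe : poly_time (fun x => encode (u x)) by exact: (poly_time_encode Pu).
by apply: (poly_time_encode (poly_time_test Ps Ph Pe)) => x; case: (s x).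
Qed.

Lemma poly_time_nilp T (eT : encodable T) (s : A -> seq T) :
  poly_time s -> poly_time (fun x => nilp (s x)).
Proof.
move=> Ps; apply: (poly_time_ext (poly_time_test Ps (poly_time_const false)
  (poly_time_const true))) => x; by case: (s x).
Qed.

Lemma poly_time_succ (n : A -> nat) : poly_time n -> poly_time (fun x => (n x).+1).
Proof.
apply: poly_time_comp.
by apply: (@poly_time_expr _ _ _ _ _ (Defs.Cons Defs.Nil (Var 0))) => x s /= ->.
Qed.

Lemma poly_time_pred (n : A -> nat) : poly_time n -> poly_time (fun x => (n x).-1).
Proof.
apply: poly_time_comp.
by apply: (@poly_time_expr _ _ _ _ _ (Tl (Var 0))) => -[|x] s /= ->.
Qed.

Lemma poly_time_eq0 (n : A -> nat) : poly_time n -> poly_time (fun x => n x == 0).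
Proof.
move=> Pn; apply: (poly_time_ext (poly_time_test Pn (poly_time_const false)
  (poly_time_const true))) => x; by case: (n x).
Qed.

Lemma poly_time_negb (b : A -> bool) : poly_time b -> poly_time (fun x => ~~ b x).
Proof.
move=> Pb; apply: (poly_time_ext (poly_time_if Pb (poly_time_const false)
  (poly_time_const true))) => x; by case: (b x).
Qed.

Lemma poly_time_andb (b c : A -> bool) :
  poly_time b -> poly_time c -> poly_time (fun x => b x && c x).
Proof. by move=> Pb Pc; apply: (poly_time_if Pb Pc (poly_time_const false)). Qed.

Lemma poly_time_orb (b c : A -> bool) :
  poly_time b -> poly_time c -> poly_time (fun x => b x || c x).
Proof. by move=> Pb Pc; apply: (poly_time_if Pb (poly_time_const true) Pc). Qed.

End Basic.
Arguments poly_time_const {A eA B eB} y.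

Lemma code_size_cat T {eT : encodable T} (s t : seq T) :
  (code_size (s ++ t)).+1 = code_size s + code_size t.
Proof.
elim: s => [|x s IH]; first by rewrite code_size_nil.
rewrite cat_cons !code_size_cons; lia.
Qed.

Lemma code_size_rev T {eT : encodable T} (s : seq T) :
  code_size (rev s) = code_size s.
Proof.
elim: s => // x s IH; apply/eqP; rewrite -eqSS rev_cons -cats1 code_size_cat IH.
by rewrite !code_size_cons code_size_nil; apply/eqP; lia.
Qed.

Lemma code_size_take T {eT : encodable T} n (s : seq T) :
  code_size (take n s) <= code_size s.
Proof.
have := code_size_cat (eT := eT) (take n s) (drop n s); rewrite cat_take_drop.
have := code_size_gt0 (eT := encodable_seq eT) (drop n s); lia.
Qed.

Lemma code_size_filter T {eT : encodable T} (p : pred T) (s : seq T) :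
  code_size [seq x <- s | p x] <= code_size s.
Proof. by elim: s => //= x s IH; case: (p x); rewrite !code_size_cons; lia. Qed.

Lemma poly_time_catrev A (eA : encodable A) T (eT : encodable T) (s t : A -> seq T) :
  poly_time s -> poly_time t -> poly_time (fun x => catrev (s x) (t x)).
Proof.
move=> Ps Pt.
have E (l m : seq T) : foldl (fun b e => e :: b) m l = catrev l m.
  by elim: l m => //= e l IH m; rewrite IH.
apply: (poly_time_ext _ (fun x => E (s x) (t x))).
apply: (@poly_time_foldl _ _ _ _ _ _ (fun _ b e => e :: b) t s
  (fun x => code_size (s x) + code_size (t x))) => //.
- apply: poly_time_cons; first exact: poly_time_snd poly_time_id.
  exact: poly_time_snd (poly_time_fst poly_time_id).
- by poly_bound.
move=> a n; rewrite E catrevE.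
have := code_size_cat (eT := eT) (rev (take n (s a))) (t a); rewrite code_size_rev.
have := code_size_take (eT := eT) n (s a); lia.
Qed.

Lemma poly_time_rev A (eA : encodable A) T (eT : encodable T) (s : A -> seq T) :
  poly_time s -> poly_time (fun x => rev (s x)).
Proof. by move=> Ps; exact: poly_time_catrev Ps (poly_time_const [::]). Qed.

Lemma poly_time_cat A (eA : encodable A) T (eT : encodable T) (s t : A -> seq T) :
  poly_time s -> poly_time t -> poly_time (fun x => s x ++ t x).
Proof.
move=> Ps Pt; apply: (poly_time_ext (poly_time_catrev (poly_time_rev Ps) Pt)) => x.
by rewrite catrevE revK.
Qed.

Lemma poly_time_map A (eA : encodable A) E T (eE : encodable E) (eT : encodable T)
    (h : A -> E -> T) (l : A -> seq E) :
  poly_time (fun p : A * E => h p.1 p.2) -> poly_time l ->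
  poly_time (fun a => [seq h a e | e <- l a]).
Proof.
move=> Ph Pl.
have R a (s : seq E) : rev (foldl (fun b e => h a e :: b) [::] s) = [seq h a e | e <- s].
  rewrite -[RHS]revK; congr rev; elim/last_ind: s => // s e IH.
  by rewrite -cats1 foldl_cat /= IH cats1 map_rcons rev_rcons.
apply: (poly_time_ext _ (fun a => R a (l a))); apply: poly_time_rev.
have [al [be H]] := poly_time_size Ph.
(* Bounds the code size of [h a e] for every [e] in [l a], since the code of [e] is no larger than
   that of the list. *)
pose (Q := fun a : A => al * (code_size a + code_size (l a) + 1) ^ be).
apply: (@poly_time_foldl _ _ _ _ _ _ (fun a b e => h a e :: b) (fun=> [::]) l
  (fun a => (code_size (l a) * (Q a).+1).+1)) => //.
- apply: poly_time_cons; last exact: poly_time_snd (poly_time_fst poly_time_id).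
  apply: (poly_time_comp (g := fun p : A * E => h p.1 p.2)
    (f := fun p : A * seq T * E => (p.1.1, p.2))) => //.
  apply: poly_time_pair; first exact: poly_time_fst (poly_time_fst poly_time_id).
  exact: poly_time_snd poly_time_id.
- exact: poly_time_const.
- by rewrite /Q; poly_bound.
move=> a n; rewrite -[foldl _ _ _]revK R code_size_rev.
apply: (@leq_trans (size (take n (l a)) * (Q a).+1).+1); last first.
  rewrite ltnS leq_mul2r (leq_trans (leq_size_code_size _)) ?orbT //.
  exact: code_size_take.
rewrite -(size_map (h a)); apply: code_size_le => k; rewrite size_map => kn y0.
have [e0 _] : exists e0 : E, True by case: (take n (l a)) kn => // e; exists e.
rewrite (nth_map e0) //; apply: leq_trans (H (a, _)) _.
rewrite /Q leq_mul2l leq_expn ?orbT // code_size_pair /=.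
have := code_size_nth (eT := eE) e0 kn; have := code_size_take (eT := eE) n (l a); lia.
Qed.

Lemma poly_time_filter A (eA : encodable A) E (eE : encodable E) (p : A -> E -> bool) (l : A -> seq E) :
  poly_time (fun q : A * E => p q.1 q.2) -> poly_time l ->
  poly_time (fun a => [seq e <- l a | p a e]).
Proof.
move=> Ph Pl.
have R a (s : seq E) :
    rev (foldl (fun b e => if p a e then e :: b else b) [::] s) = [seq e <- s | p a e].
  rewrite -[RHS]revK; congr rev; elim/last_ind: s => // s e IH.
  by rewrite -cats1 foldl_cat /= IH cats1 filter_rcons; case: ifP; rewrite ?rev_rcons.
apply: (poly_time_ext _ (fun a => R a (l a))); apply: poly_time_rev.
apply: (@poly_time_foldl _ _ _ _ _ _ (fun a b e => if p a e then e :: b else b)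
  (fun=> [::]) l (fun a => code_size (l a))) => //.
- apply: poly_time_if.
  + apply: (poly_time_comp (g := fun q : A * E => p q.1 q.2)
      (f := fun q : A * seq E * E => (q.1.1, q.2))) => //.
    apply: poly_time_pair; first exact: poly_time_fst (poly_time_fst poly_time_id).
    exact: poly_time_snd poly_time_id.
  + apply: poly_time_cons; first exact: poly_time_snd poly_time_id.
    exact: poly_time_snd (poly_time_fst poly_time_id).
  + exact: poly_time_snd (poly_time_fst poly_time_id).
- exact: poly_time_const.
- by poly_bound.
move=> a n; rewrite -[foldl _ _ _]revK R code_size_rev.
exact: leq_trans (code_size_filter _ _) (code_size_take _ _).
Qed.

Lemma poly_time_has A (eA : encodable A) E (eE : encodable E) (p : A -> E -> bool) (l : A -> seq E) :
  poly_time (fun q : A * E => p q.1 q.2) -> poly_time l ->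
  poly_time (fun a => has (p a) (l a)).
Proof.
move=> Pp Pl.
apply: (poly_time_ext (poly_time_negb (poly_time_nilp (poly_time_filter Pp Pl)))).
by move=> a; rewrite /nilp size_filter has_count -lt0n.
Qed.

Lemma poly_time_flatten A (eA : encodable A) T (eT : encodable T) (s : A -> seq (seq T)) :
  poly_time s -> poly_time (fun x => flatten (s x)).
Proof.
move=> Ps.
have E (l : seq (seq T)) : foldl cat [::] l = flatten l.
  by elim/last_ind: l => // l e IH; rewrite foldl_rcons IH flatten_rcons.
apply: (poly_time_ext _ (fun x => E (s x))).
apply: (@poly_time_foldl _ _ _ _ _ _ (fun _ b e => b ++ e) (fun=> [::]) s
  (fun x => code_size (s x))) => //.
- apply: poly_time_cat; last exact: poly_time_snd poly_time_id.
  exact: poly_time_snd (poly_time_fst poly_time_id).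
- exact: poly_time_const.
- by poly_bound.
move=> a n; rewrite -/cat E; apply: leq_trans (code_size_take n _).
elim: (take n (s a)) => //= l ss IH.
have := code_size_cat (eT := eT) l (flatten ss); rewrite code_size_cons.
have := code_size_gt0 (eT := encodable_seq eT) l; lia.
Qed.

Lemma poly_time_size_seq A (eA : encodable A) T (eT : encodable T) (s : A -> seq T) :
  poly_time s -> poly_time (fun x => size (s x)).
Proof.
move=> Ps.
apply: (poly_time_encode (f := fun x => [seq false | _ <- s x])) => [|x].
  by apply: poly_time_map => //; exact: poly_time_const.
by elim: (s x) => // e l IH; exact: (congr1 (Node Leaf) IH).
Qed.

Lemma poly_time_nseq A (eA : encodable A) (n : A -> nat) :
  poly_time n -> poly_time (fun x => nseq (n x) false).
Proof.
by move=> Pn; apply: (poly_time_encode Pn) => x; elim: (n x) => // k IH; exact: (congr1 (Node Leaf) IH).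
Qed.

Lemma poly_time_iter A (eA : encodable A) B (eB : encodable B) (h : A -> B -> B) (i : A -> B)
    (n : A -> nat) (q : A -> nat) :
  poly_time (fun p : A * B => h p.1 p.2) -> poly_time i -> poly_time n ->
  poly_bounded q ->
  (forall a k, k <= n a -> code_size (iter k (h a) (i a)) <= q a) ->
  poly_time (fun a => iter (n a) (h a) (i a)).
Proof.
move=> Ph Pi Pn Pq Hq.
have E a b k : foldl (fun b _ => h a b) b (nseq k false) = iter k (h a) b.
  by elim: k b => // k IH b; rewrite [LHS]/= IH -iterSr.
apply: (poly_time_ext _ (fun a => E a (i a) (n a))).
apply: (@poly_time_foldl _ _ _ _ _ _ (fun a b _ => h a b) i (fun a => nseq (n a) false) q) => //.
- apply: (poly_time_comp (g := fun p : A * B => h p.1 p.2)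
    (f := fun p : A * B * bool => p.1)) => //.
  exact: poly_time_fst poly_time_id.
- exact: poly_time_nseq.
move=> a k; case: (leqP k (n a)) => kn.
  by rewrite take_nseq // E; exact: Hq.
by rewrite take_oversize ?size_nseq ?(ltnW kn) // E; exact: Hq.
Qed.

Lemma poly_time_drop A (eA : encodable A) T (eT : encodable T) (n : A -> nat) (s : A -> seq T) :
  poly_time n -> poly_time s -> poly_time (fun x => drop (n x) (s x)).
Proof.
move=> Pn Ps; apply: (poly_time_ext (f := fun x => iter (n x) behead (s x))); last first.
  by move=> x; rewrite drop_behead.
apply: (@poly_time_iter _ _ _ _ (fun=> behead) s n (fun x => code_size (s x))) => //.
- exact: poly_time_behead (poly_time_snd poly_time_id).
- by poly_bound.
by move=> a k _; rewrite -drop_behead; exact: code_size_drop.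
Qed.

Lemma poly_time_nth A (eA : encodable A) T (eT : encodable T) x0 (n : A -> nat) (s : A -> seq T) :
  poly_time n -> poly_time s -> poly_time (fun x => nth x0 (s x) (n x)).
Proof.
move=> Pn Ps.
apply: (poly_time_ext (poly_time_head (poly_time_const x0) (poly_time_drop Pn Ps))) => x.
by rewrite -nth0 nth_drop addn0.
Qed.

Lemma poly_time_sub A (eA : encodable A) (n k : A -> nat) :
  poly_time n -> poly_time k -> poly_time (fun x => n x - k x).
Proof.
move=> Pn Pk.
have E a b : iter b predn a = a - b by elim: b => [|b IH]; rewrite ?subn0 // iterS IH subnS.
apply: (poly_time_ext _ (fun x => E (n x) (k x))).
apply: (@poly_time_iter _ _ _ _ (fun=> predn) n k (fun x => code_size (n x))) => //.
- exact: poly_time_pred (poly_time_snd poly_time_id).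
- by poly_bound.
by move=> a j _; rewrite E !code_size_nat; lia.
Qed.

Lemma poly_time_add A (eA : encodable A) (n k : A -> nat) :
  poly_time n -> poly_time k -> poly_time (fun x => n x + k x).
Proof.
move=> Pn Pk.
have E a b : iter b succn a = a + b by elim: b => [|b IH]; rewrite ?addn0 // iterS IH addnS.
apply: (poly_time_ext _ (fun x => E (n x) (k x))).
apply: (@poly_time_iter _ _ _ _ (fun=> succn) n k (fun x => code_size (n x) + code_size (k x))) => //.
- exact: poly_time_succ (poly_time_snd poly_time_id).
- by poly_bound.
by move=> a j ja; rewrite E !code_size_nat; lia.
Qed.

Lemma poly_time_mul A (eA : encodable A) (n k : A -> nat) :
  poly_time n -> poly_time k -> poly_time (fun x => n x * k x).
Proof.
move=> Pn Pk.
have E a b : iter b (addn a) 0 = a * b by elim: b => [|b IH]; rewrite ?muln0 // iterS IH mulnS.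
apply: (poly_time_ext _ (fun x => E (n x) (k x))).
apply: (@poly_time_iter _ _ _ _ (fun a => addn (n a)) (fun=> 0) k
  (fun x => 2 * (code_size (n x) * code_size (k x)) + 1)) => //.
- apply: poly_time_add; last exact: poly_time_snd poly_time_id.
  by apply: (poly_time_comp (g := n) (f := fst)) => //; exact: poly_time_fst poly_time_id.
- exact: poly_time_const.
- by poly_bound.
by move=> a j ja; rewrite E !code_size_nat; nia.
Qed.

Lemma poly_time_exp A (eA : encodable A) d (n : A -> nat) : poly_time n -> poly_time (fun x => n x ^ d).
Proof.
move=> Pn; elim: d => [|d IH]; first exact: poly_time_const.
by apply: (poly_time_ext (poly_time_mul Pn IH)) => x; rewrite expnS.
Qed.

Lemma poly_time_leq A (eA : encodable A) (n k : A -> nat) :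
  poly_time n -> poly_time k -> poly_time (fun x => n x <= k x).
Proof. by move=> Pn Pk; exact: poly_time_eq0 (poly_time_sub Pn Pk). Qed.

Lemma poly_time_iota A (eA : encodable A) (n : A -> nat) :
  poly_time n -> poly_time (fun x => iota 0 (n x)).
Proof.
move=> Pn.
have E k : iter k (fun p => (p.1.+1, p.1 :: p.2)) (0, [::]) = (k, rev (iota 0 k)).
  elim: k => // k IH; rewrite iterS IH /=.
  by rewrite -[0 :: _]/(iota 0 k.+1) -addn1 iotaD cats1 rev_rcons add0n addn1.
apply: (poly_time_ext (f := fun x =>
    rev (iter (n x) (fun p => (p.1.+1, p.1 :: p.2)) (0, [::])).2)); last first.
  by move=> x; rewrite E revK.
apply/poly_time_rev/poly_time_snd.
apply: (@poly_time_iter _ _ _ _ (fun=> fun p => (p.1.+1, p.1 :: p.2)) (fun=> (0, [::])) n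
  (fun x => 10 + 10 * code_size (n x) ^ 2)) => //.
- apply: poly_time_pair.
    exact: poly_time_succ (poly_time_fst (poly_time_snd poly_time_id)).
  apply: poly_time_cons; first exact: (poly_time_fst (poly_time_snd poly_time_id)).
  exact: (poly_time_snd (poly_time_snd poly_time_id)).
- exact: poly_time_const.
- by poly_bound.
move=> a k ka; rewrite E code_size_pair /= code_size_rev.
have : code_size (iota 0 k) <= (size (iota 0 k) * (k.*2.+1).+1).+1.
  apply: code_size_le => j; rewrite size_iota => jk x0.
  by rewrite nth_iota // code_size_nat; lia.
rewrite size_iota !code_size_nat; nia.
Qed.

Lemma poly_time_take A (eA : encodable A) T (eT : encodable T) (n : A -> nat) (s : A -> seq T) :
  poly_time n -> poly_time s -> poly_time (fun x => take (n x) (s x)).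
Proof.
move=> Pn Ps.
apply: (poly_time_ext (poly_time_rev (poly_time_drop
  (poly_time_sub (poly_time_size_seq Ps) Pn) (poly_time_rev Ps)))) => x.
by rewrite -size_rev -take_rev revK.
Qed.


(** * Equality tests *)

Definition poly_time_eq (T : eqType) {eT : encodable T} : Prop :=
  poly_time (fun p : T * T => p.1 == p.2).
Arguments poly_time_eq T {eT}.

Lemma poly_time_eqop A (eA : encodable A) (T : eqType) (eT : encodable T)
    (u v : A -> T) :
  poly_time_eq T -> poly_time u -> poly_time v -> poly_time (fun x => u x == v x).
Proof.
move=> PT Pu Pv.
exact: (poly_time_comp (g := fun p : T * T => p.1 == p.2) PT (poly_time_pair Pu Pv)).
Qed.

Lemma poly_time_eq_bool : poly_time_eq bool.
Proof.
have P1 : poly_time (fun p : bool * bool => p.1) by exact: poly_time_fst poly_time_id.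
have P2 : poly_time (fun p : bool * bool => p.2) by exact: poly_time_snd poly_time_id.
rewrite /poly_time_eq; apply: (poly_time_ext (poly_time_if P1 P2 (poly_time_negb P2))) => -[a b] /=.
by case: a; case: b.
Qed.

Lemma poly_time_eq_nat : poly_time_eq nat.
Proof.
have P1 : poly_time (fun p : nat * nat => p.1) by exact: poly_time_fst poly_time_id.
have P2 : poly_time (fun p : nat * nat => p.2) by exact: poly_time_snd poly_time_id.
rewrite /poly_time_eq; apply: (poly_time_ext (poly_time_andb (poly_time_leq P1 P2) (poly_time_leq P2 P1))) => p.
by rewrite -eqn_leq.
Qed.

Lemma poly_time_eq_prod (T U : eqType) (eT : encodable T) (eU : encodable U) :
  poly_time_eq T -> poly_time_eq U -> poly_time_eq (T * U)%type.
Proof.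
move=> PT PU.
have P1 : poly_time (fun p : T * U * (T * U) => p.1) by exact: poly_time_fst poly_time_id.
have P2 : poly_time (fun p : T * U * (T * U) => p.2) by exact: poly_time_snd poly_time_id.
rewrite /poly_time_eq; apply: (poly_time_ext (poly_time_andb
  (poly_time_eqop PT (poly_time_fst P1) (poly_time_fst P2))
  (poly_time_eqop PU (poly_time_snd P1) (poly_time_snd P2)))) => -[[a b] [c d]].
by rewrite xpair_eqE.
Qed.

Lemma poly_time_eq_seq (T : eqType) (eT : encodable T) :
  poly_time_eq T -> poly_time_eq (seq T).
Proof.
move=> PT.
(* The fold over the first list carries whether all entries so far agreed, and the unread part of
   the second list. The lists are equal when the flag survives and nothing is left unread. *)
pose h (p : bool * seq T) e :=
  if nilp p.2 then (false, [::]) else (p.1 && (e == head e p.2), behead p.2).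
have F (s : seq T) t : (foldl h (false, t) s).1 = false.
  elim: s t => //= e s IH t; rewrite /h /=; case: (nilp t); exact: IH.
have E (s t : seq T) :
    (foldl h (true, t) s).1 && nilp (foldl h (true, t) s).2 = (s == t).
  elim: s t => [|e s IH] [|f t] //=; first by rewrite /h F.
  rewrite /h /= -/h eqseq_cons; case: eqP => _ /=; first exact: IH.
  by rewrite F.
rewrite /poly_time_eq; apply: (poly_time_ext _ (fun p : seq T * seq T => E p.1 p.2)).
have Pfold : poly_time (fun p : seq T * seq T => foldl h (true, p.2) p.1).
  apply: (@poly_time_foldl _ _ _ _ _ _ (fun=> h) (fun p => (true, p.2)) (fun p => p.1)
    (fun p => 10 + code_size p)).
  - pose D := (seq T * seq T * (bool * seq T) * T)%type.
    have Pe : poly_time (fun x : D => x.2) by exact: poly_time_snd poly_time_id.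
    have Pp : poly_time (fun x : D => x.1.2).
      exact: poly_time_snd (poly_time_fst poly_time_id).
    apply: poly_time_if; first exact: poly_time_nilp (poly_time_snd Pp).
      exact: poly_time_const.
    apply: poly_time_pair; last exact: poly_time_behead (poly_time_snd Pp).
    apply: poly_time_andb; first exact: poly_time_fst.
    apply: poly_time_eqop => //; exact: poly_time_head (poly_time_snd Pp).
  - exact: poly_time_pair (poly_time_const true) (poly_time_snd poly_time_id).
  - exact: poly_time_fst poly_time_id.
  - by poly_bound.
  move=> [s t] n /=.
  have hs p e : code_size (h p e).2 <= code_size p.2.
    by rewrite /h; case: p => b [|f l] //=; rewrite code_size_cons; lia.
  have : code_size (foldl h (true, t) (take n s)).2 <= code_size (true, t).2.
    elim: (take n s) (true, t) => //= e l IH p; exact: leq_trans (IH _) (hs _ _).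
  case: (foldl h _ _) => b l /=; rewrite !code_size_pair /=.
  have := code_size_bool b; lia.
by apply: poly_time_andb; [exact: poly_time_fst|exact: poly_time_nilp (poly_time_snd _)].
Qed.

Lemma poly_time_mem A (eA : encodable A) (T : eqType) (eT : encodable T)
    (u : A -> T) (s : A -> seq T) :
  poly_time_eq T -> poly_time u -> poly_time s -> poly_time (fun x => u x \in s x).
Proof.
move=> PT Pu Ps; apply: (poly_time_ext (f := fun x => has (fun e => u x == e) (s x))).
  apply: poly_time_has => //; apply: poly_time_eqop => //; last first.
    exact: poly_time_snd poly_time_id.
  by apply: (poly_time_comp (g := u) (f := fst)) => //; exact: poly_time_fst poly_time_id.
by move=> x; elim: (s x) => //= e l ->; rewrite inE.
Qed.

(** * The reduction as a function *)

Local Open Scope nat_scope.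

(** Halves, logarithms and roots are all computed by counting the numbers in [iota 0 n] that pass a
    test, the test being true exactly below the wanted value. *)
Lemma size_filter_lt n t : size [seq i <- iota 0 n | i < t] = minn t n.
Proof.
elim: n => [|n IH]; first by rewrite minn0.
rewrite -addn1 iotaD filter_cat size_cat IH /= add0n.
by case: ltnP => /=; rewrite ?addn0 ?addn1; lia.
Qed.

Lemma half_filter n : size [seq j <- iota 0 n | (j + j).+1 < n] = n./2.
Proof.
under eq_filter => j do have -> : ((j + j).+1 < n) = (j < n./2) by lia.
by rewrite size_filter_lt; lia.
Qed.

(** The logarithm is the number of [i] with [2 ^ i.+1 <= n]. *)
Lemma binary_digitsE n : binary_digits n =
  [seq odd (n %/ 2 ^ i) |
    i <- iota 0 (size [seq i <- iota 0 n | 0 < n %/ 2 ^ i.+1]).+1].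
Proof.
rewrite /binary_digits; congr (map _ (iota 0 _.+1)).
case: (posnP n) => [->|n0]; first by rewrite trunc_log0.
under eq_filter => i.
  have -> : (0 < n %/ 2 ^ i.+1) = (i < trunc_log 2 n).
    rewrite divn_gt0 ?expn_gt0 //; apply/idP/idP => [|it].
      exact: trunc_log_max.
    apply: leq_trans (trunc_logP (isT : 1 < 2) n0); by rewrite leq_pexp2l.
  over.
rewrite size_filter_lt; apply/esym/minn_idPl.
apply: leq_trans (trunc_logP (isT : 1 < 2) n0); exact/ltnW/ltn_expl.
Qed.

Lemma binary_digits_rec n : 1 < n -> binary_digits n = odd n :: binary_digits n./2.
Proof.
move=> n1; rewrite /binary_digits trunc_log2S //.
rewrite -[iota 0 _.+2]/(0 :: iota (1 + 0) (trunc_log 2 n./2).+1) iotaDl map_cons -map_comp.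
rewrite expn0 divn1; congr (_ :: _); apply: eq_map => i /=.
by rewrite add1n expnS divnMA divn2.
Qed.

(** The inverse evaluates the digits, least significant first. Injectivity is what allows a binary
    number to be decoded by search and rationals to be compared through their digits. *)
Lemma binary_digits_inj : injective binary_digits.
Proof.
pose value := foldr (fun (b : bool) v => b + v.*2) 0.
apply: (@can_inj _ _ _ value); apply: ltn_ind => n IH.
case: (ltnP 1 n) => n1; last by case: n n1 {IH} => [|[|]].
rewrite binary_digits_rec // -[LHS]/(odd n + (value (binary_digits n./2)).*2).
by rewrite IH ?odd_double_half //; lia.
Qed.

(** [pt] derives [poly_time] from the syntax of a function; [pt_user] is a hook, redefined whenever
    further operations have been shown to be polynomial. *)
Ltac pt_user := fail.
Ltac pt_step := lazymatch goal with
  | |- poly_time (fun x => x) => exact poly_time_id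
  | |- poly_time id => exact poly_time_id
  | |- poly_time fst => exact (poly_time_fst poly_time_id)
  | |- poly_time snd => exact (poly_time_snd poly_time_id)
  | |- poly_time (fun _ => ?b) => apply (poly_time_const b)
  | |- poly_time (fun x => fst (@?u x)) => refine (poly_time_fst _)
  | |- poly_time (fun x => snd (@?u x)) => refine (poly_time_snd _)
  | |- poly_time (fun x => pair (@?u x) (@?v x)) => refine (poly_time_pair _ _)
  | |- poly_time (fun x => andb (@?u x) (@?v x)) => refine (poly_time_andb _ _)
  | |- poly_time (fun x => orb (@?u x) (@?v x)) => refine (poly_time_orb _ _)
  | |- poly_time (fun x => negb (@?u x)) => refine (poly_time_negb _)
  | |- poly_time (fun x => cons (@?u x) (@?v x)) => refine (poly_time_cons _ _)
  | |- poly_time (fun x => cat (@?u x) (@?v x)) => refine (poly_time_cat _ _)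
  | |- poly_time (fun x => flatten (@?u x)) => refine (poly_time_flatten _)
  | |- poly_time (fun x => size (@?u x)) => refine (poly_time_size_seq _)
  | |- poly_time (fun x => take (@?u x) (@?v x)) => refine (poly_time_take _ _)
  | |- poly_time (fun x => drop (@?u x) (@?v x)) => refine (poly_time_drop _ _)
  | |- poly_time (fun x => iota 0 (@?u x)) => refine (poly_time_iota _)
  | |- poly_time (fun x => nth (@?u x) (@?v x) (@?w x)) => refine (poly_time_nth _ _ _)
  | |- poly_time (fun x => S (@?u x)) => refine (poly_time_succ _)
  | |- poly_time (fun x => addn (@?u x) (@?v x)) => refine (poly_time_add _ _)
  | |- poly_time (fun x => expn (@?u x) (@?v x)) => refine (poly_time_exp _ _)
  | |- poly_time (fun x => leq (@?u x) (@?v x)) => refine (poly_time_leq _ _)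
  | |- poly_time (fun x => map (fun e => @?h x e) (@?l x)) =>
      refine (@poly_time_map _ _ _ _ _ _ h l _ _); cbv beta
  | |- poly_time (fun x => [seq e <- (@?l x) | @?h x e]) =>
      refine (@poly_time_filter _ _ _ _ h l _ _); cbv beta
  | |- poly_time (fun x => has (fun e => @?h x e) (@?l x)) =>
      refine (@poly_time_has _ _ _ _ h l _ _); cbv beta
  | |- _ => pt_user
  end.
Ltac pt := repeat (first [assumption | pt_step]).

Lemma poly_time_half A (eA : encodable A) (n : A -> nat) :
  poly_time n -> poly_time (fun x => (n x)./2).
Proof.
apply: poly_time_comp; apply: (poly_time_ext _ half_filter); pt.
Qed.

Lemma poly_time_odd A (eA : encodable A) (n : A -> nat) :
  poly_time n -> poly_time (fun x => odd (n x)).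
Proof.
move=> Pn; have Ph := poly_time_half Pn.
apply: (poly_time_ext (f := fun x => (n x)./2 + (n x)./2 < n x)); first by pt.
by move=> x; lia.
Qed.

(** The power [2 ^ i] is too large to be written in unary, so the quotient is reached by halving [i]
    times. *)
Lemma poly_time_divn_exp2 A (eA : encodable A) (n i : A -> nat) :
  poly_time n -> poly_time i -> poly_time (fun x => n x %/ 2 ^ i x).
Proof.
move=> Pn Pi.
have E m k : iter k half m = m %/ 2 ^ k.
  by elim: k => [|k IH]; rewrite ?divn1 // iterS IH -divn2 -divnMA expnSr.
apply: (poly_time_ext _ (fun x => E (n x) (i x))).
apply: (@poly_time_iter _ _ _ _ (fun=> half) n i (fun x => code_size (n x))) => //.
- exact: poly_time_half (poly_time_snd poly_time_id).
- by poly_bound.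
by move=> a j _; rewrite E !code_size_nat ltnS leq_double leq_div.
Qed.

Lemma poly_time_binary_digits A (eA : encodable A) (n : A -> nat) :
  poly_time n -> poly_time (fun x => binary_digits (n x)).
Proof.
apply: poly_time_comp; apply: (poly_time_ext _ (fun n => esym (binary_digitsE n))).
pt; last by apply: poly_time_divn_exp2; pt.
by apply/poly_time_odd/poly_time_divn_exp2; pt.
Qed.

Section Pairs.
Variables (n : nat) (P : nat -> nat -> bool).

Definition pairs : seq (nat * nat) :=
  flatten [seq [seq (i, j) | j <- [seq j <- iota 0 n | P i j]] | i <- iota 0 n].

Lemma size_pairs : size pairs = #|[set p : 'I_n * 'I_n | P p.1 p.2]|.
Proof.
have iotaE : iota 0 n = index_iota 0 n by rewrite /index_iota subn0.
rewrite /pairs size_flatten /shape -map_comp sumnE big_map.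
rewrite -sum1dep_card -(pair_big_dep xpredT (fun i j : 'I_n => P i j) (fun _ _ => 1)) /=.
rewrite iotaE big_mkord; apply: eq_bigr => i _.
by rewrite /= size_map size_filter -sum1_count big_mkord.
Qed.

End Pairs.

Instance encodable_rV m : encodable 'rV[rat]_m := @enc_rV m.

(** * Points on a grid *)

Fixpoint grid (D m : nat) : seq (seq nat) :=
  if D is D'.+1 then flatten [seq [seq x :: v | v <- grid D' m] | x <- iota 0 m]
  else [:: [::]].

(** For positive [D], the [D]-th root of [n] rounded up. *)
Definition side (D n : nat) : nat := size [seq j <- iota 0 n | j ^ D < n].

Definition coord (D n i j : nat) : nat := nth 0 (nth [::] (grid D (side D n)) i) j.

Definition point (D n i : nat) : 'rV[rat]_D := (\row_(j < D) (coord D n i j)%:R)%R.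

Lemma uniq_grid D m : uniq (grid D m).
Proof.
elim: D => //= D IH; apply: allpairs_uniq => //; first exact: iota_uniq.
by move=> [x v] [y w] _ _ /= [-> ->].
Qed.

Lemma size_grid D m : size (grid D m) = m ^ D.
Proof. by elim: D => //= D IH; rewrite size_allpairs size_iota IH expnS. Qed.

Lemma mem_grid D m v : (v \in grid D m) = (size v == D) && all (fun x => x < m) v.
Proof.
elim: D v => [|D IH] [|x v] //=.
  by apply/negbTE/negP => /allpairsP[[y w] []].
apply/allpairsP/idP => [[[y w] [/= ym wg [-> ->]]]|].
  by move: ym wg; rewrite mem_iota add0n IH eqSS => /= -> .
rewrite eqSS => /and3P[sv xm vm]; exists (x, v).
by rewrite /= mem_iota IH sv vm.
Qed.

(** The first part gives the grid room for [n] points. The second puts every coordinate below the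
    real root of [n], so that rounding up costs nothing in distances. As [n <= n ^ D], the root is
    at most [n] and the count over [iota 0 n] is not cut off. *)
Lemma side_spec D n : 0 < D ->
  n <= side D n ^ D /\ forall j, j < side D n -> j ^ D < n.
Proof.
move=> D0.
have n_le : n <= n ^ D.
  by case: D D0 => // D _; rewrite expnS; case: n => // n; rewrite leq_pmulr ?expn_gt0.
have ex : exists j, n <= j ^ D by exists n.
have [m nm mmin] := ex_minnP ex.
have lt_m j : (j ^ D < n) = (j < m).
  apply/idP/idP => [jn|]; last by rewrite !ltnNge; apply/contra/mmin.
  by rewrite -(ltn_exp2r _ _ D0); apply: leq_trans jn nm.
have mn : m <= n by exact: mmin.
have -> : side D n = m.
  rewrite /side; under eq_filter => j do rewrite lt_m.
  by rewrite size_filter_lt; apply/minn_idPl.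
by split=> // j jm; rewrite lt_m.
Qed.

Lemma nth_grid D n i : 0 < D -> i < n ->
  nth [::] (grid D (side D n)) i \in grid D (side D n).
Proof.
move=> D0 ni; apply: mem_nth; rewrite size_grid.
by apply: leq_trans ni _; exact: (side_spec n D0).1.
Qed.

Lemma coord_ltn D n i j : 0 < D -> i < n -> j < D -> coord D n i j < side D n.
Proof.
move=> D0 ni jD; have := nth_grid D0 ni; rewrite mem_grid => /andP[/eqP sz /allP H].
by apply/H/mem_nth; rewrite sz.
Qed.

Lemma coord_inj D n i i' : 0 < D -> i < n -> i' < n ->
  (forall j, j < D -> coord D n i j = coord D n i' j) -> i = i'.
Proof.
move=> D0 ni ni' H; have := nth_grid D0 ni; have := nth_grid D0 ni'.
rewrite !mem_grid => /andP[/eqP s2 _] /andP[/eqP s1 _].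
have sz : n <= size (grid D (side D n)) by rewrite size_grid; exact: (side_spec n D0).1.
apply/eqP; rewrite -(nth_uniq [::] _ _ (uniq_grid D (side D n))); last 2 first.
- exact: leq_trans ni sz.
- exact: leq_trans ni' sz.
by apply/eqP/(@eq_from_nth _ 0); rewrite s1 ?s2 // => j /H.
Qed.

Lemma point_inj D n : 0 < D -> injective (fun i : 'I_n => point D n i).
Proof.
move=> D0 i i' /rowP eqp; apply/val_inj/(coord_inj D0 (ltn_ord i) (ltn_ord i')) => j jD.
have := eqp (Ordinal jD); rewrite !mxE /= => /eqP.
by rewrite eqr_nat => /eqP.
Qed.

(** A rational as nested bit lists with the same code, a type on which equality is already known to
    be polynomial. *)
Definition code_rat (q : rat) : (bool * seq bool) * (bool * seq bool) :=
  ((numq q < 0, binary_digits `|numq q|), (denq q < 0, binary_digits `|denq q|))%R.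

Definition code_rV m (v : 'rV[rat]_m) := [seq code_rat (v ord0 j) | j <- enum 'I_m].

Lemma encode_code_rV m (v : 'rV[rat]_m) : encode (code_rV v) = encode v.
Proof.
rewrite /encode /encodable_rV /enc_rV /code_rV /encodable_seq.
by elim: (enum 'I_m) => //= j s ->.
Qed.

Lemma code_rat_inj : injective code_rat.
Proof.
move=> p q /eqP; rewrite /code_rat !xpair_eqE.
move=> /andP[/andP[/eqP n1 /eqP/binary_digits_inj n2]].
move=> /andP[/eqP d1 /eqP/binary_digits_inj d2].
have absz_inj (x y : int) : (x < 0 = (y < 0))%R -> `|x|%N = `|y|%N -> x = y by lia.
by rewrite -[p]divq_num_den -[q]divq_num_den (absz_inj _ _ n1 n2) (absz_inj _ _ d1 d2).
Qed.

Lemma code_rV_inj m : injective (@code_rV m).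
Proof.
move=> v w /eq_in_map E; apply/rowP => j; apply/code_rat_inj/E.
exact: mem_enum.
Qed.

Lemma poly_time_eq_rV m : poly_time_eq 'rV[rat]_m.
Proof.
have P : poly_time_eq (seq ((bool * seq bool) * (bool * seq bool))).
  apply/poly_time_eq_seq/poly_time_eq_prod;
    apply/poly_time_eq_prod; [exact: poly_time_eq_bool| |exact: poly_time_eq_bool|];
    exact/poly_time_eq_seq/poly_time_eq_bool.
have Pc A (eA : encodable A) (u : A -> 'rV[rat]_m) :
    poly_time u -> poly_time (fun x => code_rV (u x)).
  by move=> Pu; apply: (poly_time_encode Pu) => x; rewrite encode_code_rV.
rewrite /poly_time_eq.
apply: (poly_time_ext (f := fun p : 'rV[rat]_m * 'rV[rat]_m => code_rV p.1 == code_rV p.2)).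
  by apply: poly_time_eqop => //; apply: Pc; pt.
by move=> p; rewrite (inj_eq (@code_rV_inj m)).
Qed.

Ltac pt_points := lazymatch goal with
  | |- poly_time (fun x => in_mem (@?u x) (mem (@?s x))) =>
      refine (poly_time_mem _ _ _); first [exact poly_time_eq_nat | exact: poly_time_eq_rV | idtac]
  | |- poly_time (fun x => binary_digits (@?u x)) => refine (poly_time_binary_digits _)
  end.
Ltac pt_user ::= pt_points.

Lemma poly_time_grid A (eA : encodable A) D (m : A -> nat) :
  poly_time m -> poly_time (fun x => grid D (m x)).
Proof.
apply: poly_time_comp; elim: D => [|D IH] /=; first by pt.
pt; by apply: (poly_time_comp IH); pt.
Qed.

Lemma poly_time_side A (eA : encodable A) D (n : A -> nat) :
  poly_time n -> poly_time (fun x => side D (n x)).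
Proof. by apply: poly_time_comp; rewrite /side; pt. Qed.

Lemma poly_time_coord A (eA : encodable A) D (n i j : A -> nat) :
  poly_time n -> poly_time i -> poly_time j ->
  poly_time (fun x => coord D (n x) (i x) (j x)).
Proof.
move=> Pn Pi Pj; rewrite /coord; pt.
by apply/poly_time_grid/poly_time_side.
Qed.

Lemma poly_time_point A (eA : encodable A) D (n i : A -> nat) :
  poly_time n -> poly_time i -> poly_time (fun x => point D (n x) (i x)).
Proof.
move=> Pn Pi.
apply: (poly_time_comp (g := fun p => point D p.1 p.2) _ (poly_time_pair Pn Pi)).
apply: (poly_time_encode (f := fun p : nat * nat =>
  [seq (false, binary_digits (coord D p.1 p.2 j), (false, binary_digits 1))
    | j <- iota 0 D])) => [|p].
  by pt; apply: poly_time_coord; pt.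
rewrite -encode_code_rV; congr encode; rewrite -val_enum_ord -map_comp.
by apply: eq_map => j; rewrite /code_rat /= mxE pmulrn numq_int denq_int.
Qed.

(** * Vertices linked by a forest *)

Section Reach.
Context {T : eqType}.
Implicit Types (F : seq (T * T)) (R : seq T).

Definition grow R (s : T * T) : seq T :=
  if (s.1 \in R) || (s.2 \in R) then [:: s.1, s.2 & R] else R.

(* Every pass over [F] advances at least one step along a path, and a simple
   path has at most [2 * size F] nodes. *)
Definition reach F (p : T) : seq T := foldl grow [:: p] (flatten [seq F | _ <- F ++ F]).

End Reach.

Lemma code_size_grow (T : eqType) {eT : encodable T} (l : seq (T * T)) R :
  code_size (foldl grow R l) <= code_size R + code_size l.
Proof.
elim: l R => [|s l IH] R /=; first by lia.
apply: leq_trans (IH _) _; rewrite code_size_cons code_size_pair /grow.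
by case: ifP => _; rewrite ?code_size_cons; lia.
Qed.

Lemma poly_time_reach A (eA : encodable A) (T : eqType) (eT : encodable T)
    (F : A -> seq (T * T)) (p : A -> T) :
  poly_time_eq T -> poly_time F -> poly_time p ->
  poly_time (fun x => reach (F x) (p x)).
Proof.
move=> PT PF Pp.
have Pl : poly_time (fun x => flatten [seq F x | _ <- F x ++ F x]).
  apply: (poly_time_comp (g := fun l : seq (T * T) => flatten [seq l | _ <- l ++ l])) PF.
  by pt.
have Pi : poly_time (fun x => [:: p x]) by pt.
apply: (@poly_time_foldl _ _ _ _ _ _ (fun=> grow) _ _
  (fun x => code_size [:: p x] + code_size (flatten [seq F x | _ <- F x ++ F x])) _ Pi Pl).
- rewrite /grow; apply: poly_time_if; last by pt.
    by apply: poly_time_orb; apply: poly_time_mem => //; pt.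
  by pt.
- by poly_bound.
move=> a n; apply: leq_trans (code_size_grow _ _) _.
by rewrite leq_add2l code_size_take.
Qed.

(** * The approximation algorithm for the densest subgraph *)

Section Graph.
Variable G : dks_instance.

Definition rows : seq (seq bool) :=
  [seq [seq @dks_adj G i j | j <- enum 'I_(dks_n G)] | i <- enum 'I_(dks_n G)].

Definition adj (i j : nat) : bool := nth false (nth [::] rows i) j.

Definition nedges (T : seq nat) : nat :=
  size (pairs (dks_n G) (fun i j => [&& i < j, adj i j, i \in T & j \in T])).

Definition edges : seq (nat * nat) := pairs (dks_n G) (fun i j => (i < j) && adj i j).

Definition linked D (F : seq ('rV[rat]_D * 'rV[rat]_D)) : seq nat :=
  [seq i <- iota 0 (dks_n G) | has (fun j => adj i j &&
     (point D (dks_n G) j \in reach F (point D (dks_n G) i))) (iota 0 (dks_n G))].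

Definition window (V : seq nat) (a : nat) : seq nat := take (dks_k G)./2 (drop a V).

(** A solution must have exactly [k] vertices, and additional vertices destroy no edges. *)
Definition pad (T : seq nat) : seq nat :=
  take (dks_k G) (T ++ [seq i <- iota 0 (dks_n G) | i \notin T]).

Definition candidate (V : seq nat) (a b : nat) : seq nat :=
  pad [seq i <- iota 0 (dks_n G) | (i \in window V a) || (i \in window V b)].

(** Windows start at every position, not only at multiples of [k/2]; this includes all the blocks of
    the analysis and spares the program a division. *)
Definition candidates (V : seq nat) : seq (seq nat) :=
  flatten [seq [seq candidate V a b | b <- iota 0 (dks_n G).+1]
    | a <- iota 0 (dks_n G).+1].

Definition better (T U : seq nat) : seq nat := if nedges T < nedges U then U else T.

Definition densest (l : seq (seq nat)) : seq nat := foldl better (pad [::]) l.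

Lemma size_rows : size rows = dks_n G.
Proof. by rewrite size_map size_enum_ord. Qed.

Lemma adjE (i j : 'I_(dks_n G)) : adj i j = @dks_adj G i j.
Proof.
by rewrite /adj (nth_map i) ?size_enum_ord // (nth_map j) ?size_enum_ord // !nth_ord_enum.
Qed.

Lemma size_edges :
  size edges = #|[set p : 'I_(dks_n G) * 'I_(dks_n G) | (p.1 < p.2) && @dks_adj G p.1 p.2]|.
Proof.
by rewrite size_pairs; apply: eq_card => p; rewrite !inE adjE.
Qed.

Lemma nedgesE T :
  nedges T = induced_edges [set i : 'I_(dks_n G) | val i \in T].
Proof.
rewrite /nedges size_pairs; apply: eq_card => p; rewrite !inE adjE.
by apply/and4P/asboolP => /= [[-> a1 a2 a3]|/and4P[-> + + ->]]; rewrite !inE ?a1 ?a2 ?a3.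
Qed.

Lemma nedges_densest l T : T \in l -> nedges T <= nedges (densest l).
Proof.
rewrite /densest; move: (pad [::]) => U Tl.
have mono (W : seq nat) l' : nedges W <= nedges (foldl better W l').
  elim: l' W => //= X l' IH W; apply: leq_trans (IH _).
  by rewrite /better; case: ltnP => // /ltnW.
elim: l U Tl => //= X l IH U; rewrite inE => /predU1P[->|/IH//].
by apply: leq_trans (mono _ _); rewrite /better; case: ltnP.
Qed.

Lemma mem_densest l : densest l \in pad [::] :: l.
Proof.
rewrite /densest; elim: l (pad [::]) => [|T l IH] U /=; first by rewrite inE.
have := IH (better U T); rewrite /better !inE.
by case: ifP => _ /orP[] ->; rewrite ?orbT.
Qed.

End Graph.

Ltac pt_reach := lazymatch goal with
  | |- poly_time (fun x => point _ (@?u x) (@?v x)) => refine (poly_time_point _ _ _)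
  | |- poly_time (fun x => reach (@?u x) (@?v x)) =>
      refine (poly_time_reach (@poly_time_eq_rV _) _ _)
  | |- poly_time (fun x => half (@?u x)) => refine (poly_time_half _)
  | |- _ => pt_points
  end.
Ltac pt_user ::= pt_reach.

Lemma poly_time_rows : poly_time rows.
Proof. by apply: (@poly_time_expr _ _ _ _ _ (Hd (Var 0))) => G s /= ->. Qed.

Lemma poly_time_dks_n : poly_time dks_n.
Proof.
by apply: (poly_time_ext (poly_time_size_seq poly_time_rows)); exact: size_rows.
Qed.

(** The instance stores [k] in binary. As [k <= n], its unary form is found by searching [0, ..., n]
    for the number with the same digits. *)
Lemma poly_time_dks_k : poly_time dks_k.
Proof.
have Pk : poly_time (fun G => binary_digits (dks_k G)).
  by apply: (@poly_time_expr _ _ _ _ _ (Tl (Var 0))) => G s /= ->.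
apply: (poly_time_ext (f := fun G =>
  nth 0 [seq j <- iota 0 (dks_n G).+1 | binary_digits j == binary_digits (dks_k G)] 0)).
  pt; last exact: poly_time_dks_n.
  apply: poly_time_eqop; first exact/poly_time_eq_seq/poly_time_eq_bool.
    by apply: poly_time_binary_digits; pt.
  by apply: (poly_time_comp Pk); pt.
move=> G; under eq_filter => j do rewrite (inj_eq binary_digits_inj).
by rewrite filter_pred1_uniq ?iota_uniq // mem_iota ltnS dks_k_le.
Qed.

Lemma poly_time_adj A (eA : encodable A) (g : A -> dks_instance) (i j : A -> nat) :
  poly_time g -> poly_time i -> poly_time j ->
  poly_time (fun x => adj (g x) (i x) (j x)).
Proof. by move=> Pg Pi Pj; rewrite /adj; pt; apply: (poly_time_comp poly_time_rows). Qed.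

Ltac pt_graph := lazymatch goal with
  | |- poly_time dks_n => exact poly_time_dks_n
  | |- poly_time dks_k => exact poly_time_dks_k
  | |- poly_time (fun x => dks_n (@?u x)) => refine (poly_time_comp poly_time_dks_n _)
  | |- poly_time (fun x => dks_k (@?u x)) => refine (poly_time_comp poly_time_dks_k _)
  | |- poly_time (fun x => adj (@?u x) (@?v x) (@?w x)) => refine (poly_time_adj _ _ _)
  | |- _ => pt_reach
  end.
Ltac pt_user ::= pt_graph.

Lemma poly_time_nedges A (eA : encodable A) (g : A -> dks_instance) (T : A -> seq nat) :
  poly_time g -> poly_time T -> poly_time (fun x => nedges (g x) (T x)).
Proof.
move=> Pg PT.
apply: (poly_time_comp (g := fun p => nedges p.1 p.2) _ (poly_time_pair Pg PT)).
by rewrite /nedges /pairs; pt.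
Qed.

Lemma poly_time_edges : poly_time edges.
Proof. by rewrite /edges /pairs; pt. Qed.

Lemma poly_time_linked A (eA : encodable A) D (g : A -> dks_instance)
    (F : A -> seq ('rV[rat]_D * 'rV[rat]_D)) :
  poly_time g -> poly_time F -> poly_time (fun x => linked (g x) (F x)).
Proof.
move=> Pg PF.
apply: (poly_time_comp (g := fun p => linked p.1 p.2) _ (poly_time_pair Pg PF)).
by rewrite /linked; pt.
Qed.

Lemma poly_time_pad A (eA : encodable A) (g : A -> dks_instance) (T : A -> seq nat) :
  poly_time g -> poly_time T -> poly_time (fun x => pad (g x) (T x)).
Proof.
move=> Pg PT.
apply: (poly_time_comp (g := fun p => pad p.1 p.2) _ (poly_time_pair Pg PT)).
by rewrite /pad; pt.
Qed.

Lemma poly_time_candidate A (eA : encodable A) (g : A -> dks_instance)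
    (V : A -> seq nat) (a b : A -> nat) :
  poly_time g -> poly_time V -> poly_time a -> poly_time b ->
  poly_time (fun x => candidate (g x) (V x) (a x) (b x)).
Proof.
move=> Pg PV Pa Pb.
apply: (poly_time_comp (g := fun p => candidate p.1.1 p.1.2 p.2.1 p.2.2) _
  (poly_time_pair (poly_time_pair Pg PV) (poly_time_pair Pa Pb))).
by rewrite /candidate; apply: poly_time_pad; rewrite /window; pt.
Qed.

Lemma poly_time_candidates A (eA : encodable A) (g : A -> dks_instance) (V : A -> seq nat) :
  poly_time g -> poly_time V -> poly_time (fun x => candidates (g x) (V x)).
Proof.
move=> Pg PV.
apply: (poly_time_comp (g := fun p => candidates p.1 p.2) _ (poly_time_pair Pg PV)).
by rewrite /candidates; pt; apply: poly_time_candidate; pt.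
Qed.

Lemma poly_time_densest A (eA : encodable A) (g : A -> dks_instance) (l : A -> seq (seq nat)) :
  poly_time g -> poly_time l -> poly_time (fun x => densest (g x) (l x)).
Proof.
move=> Pg Pl; have Pp : poly_time (fun x => pad (g x) [::]) by apply: poly_time_pad => //; pt.
apply: (@poly_time_foldl _ _ _ _ _ _ (fun x => better (g x)) (fun x => pad (g x) [::]) l
  (fun x => code_size (pad (g x) [::] :: l x))) => //.
- have Pg1 : poly_time (fun p : A * seq nat * seq nat => g p.1.1).
    by apply: (poly_time_comp Pg); pt.
  rewrite /better; apply: poly_time_if; [|by pt|by pt].
  by apply: poly_time_leq; first apply: poly_time_succ; apply: poly_time_nedges; pt.
- by apply: poly_time_size; pt.
move=> x n; rewrite -/(densest (g x) (take n (l x))).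
apply: code_size_mem; have := mem_densest (g x) (take n (l x)).
by rewrite !inE => /predU1P[->|/mem_take ->]; rewrite ?eqxx ?orbT.
Qed.

(** * The reduction and its running time *)

Section Reduction.
Variables (D : nat) (D_gt0 : 0 < D).

Definition demands (G : dks_instance) : {set 'I_(dks_n G) * 'I_(dks_n G)} :=
  [set p : 'I_(dks_n G) * 'I_(dks_n G) | (p.1 < p.2) && @dks_adj G p.1 p.2].

Lemma demands_lt G (p : 'I_(dks_n G) * 'I_(dks_n G)) : p \in demands G -> p.1 < p.2.
Proof. by rewrite inE => /andP[]. Qed.

(** An instance may not ask for more demands than it has; replacing an excessive [l] by 0 makes
    [to_kforest] total. *)
Lemma guard_le G l : (if l <= #|demands G| then l else 0) <= #|demands G|.
Proof. by case: ifP. Qed.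

Definition to_kforest (G : dks_instance) (l : nat) : kforest_instance D :=
  KforestInstance (point_inj (n := dks_n G) D_gt0) (@demands_lt G) (guard_le G l).

Lemma poly_time_to_kforest A (eA : encodable A) (g : A -> dks_instance) (l : A -> nat) :
  poly_time g -> poly_time l -> poly_time (fun x => to_kforest (g x) (l x)).
Proof.
move=> Pg Pl.
apply: (poly_time_comp (g := fun p => to_kforest p.1 p.2) _ (poly_time_pair Pg Pl)).
apply: (poly_time_encode (f := fun p : dks_instance * nat =>
  ([seq point D (dks_n p.1) i | i <- iota 0 (dks_n p.1)],
   ([seq [seq (i < j) && adj p.1 i j | j <- iota 0 (dks_n p.1)] | i <- iota 0 (dks_n p.1)],
    binary_digits (if p.2 <= size (edges p.1) then p.2 else 0))))) => [|[G k]].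
  pt; apply: poly_time_if; [|by pt|by pt].
  by apply: poly_time_leq; first pt; apply: poly_time_size_seq;
     apply: (poly_time_comp poly_time_edges); pt.
rewrite /encode /encodable_kforest /enc_kforest /to_kforest /= size_edges -/(demands G).
rewrite /encodable_prod /enc_pair /=; congr (Node _ (Node _ _)).
  rewrite -[iota _ _]val_enum_ord -map_comp; congr (enc_seq _ _).
rewrite /enc_rel -[iota _ _]val_enum_ord -map_comp; congr (enc_seq _ _).
apply: eq_map => i /=; rewrite -map_comp; apply: eq_map => j /=.
by rewrite inE adjE.
Qed.

Variable K : kforest_instance D -> seq ('rV[rat]_D * 'rV[rat]_D).

Definition dks_solution (G : dks_instance) : seq nat :=
  densest G (flatten [seq candidates G (linked G (K (to_kforest G l)))
                     | l <- iota 0 (size (edges G)).+1]).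

Definition dks_mask (G : dks_instance) : seq bool :=
  [seq i \in dks_solution G | i <- iota 0 (dks_n G)].

Lemma poly_time_dks_mask : poly_time K -> poly_time dks_mask.
Proof.
move=> PK.
have PE := poly_time_edges.
have Ps : poly_time dks_solution.
  apply: poly_time_densest; first by pt.
  pt; apply: poly_time_candidates; first by pt.
  apply: poly_time_linked; first by pt.
  by apply: (poly_time_comp PK); apply: poly_time_to_kforest; pt.
rewrite /dks_mask; pt; by apply: (poly_time_comp Ps); pt.
Qed.

End Reduction.

(** * Correctness of the component search *)

Section ReachCorrect.
Variables (T : eqType) (F : seq (T * T)).

(** The relation [adjacent] over an arbitrary type, so that it serves both rational and real
    nodes. *)
Definition linkedb : rel T := fun p q => ((p, q) \in F) || ((q, p) \in F).

Lemma grow_sub (R : seq T) l x : x \in R -> x \in foldl grow R l.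
Proof.
elim: l R => //= s l IH R xR; apply: IH.
by rewrite /grow; case: ifP; rewrite // !inE xR !orbT.
Qed.

(** The order of the segments does not matter: nodes are never removed, so [x] is still present when
    the segment between [x] and [y] comes up. *)
Lemma grow_step R x y : x \in R -> linkedb x y -> y \in foldl grow R F.
Proof.
move=> xR; have main l : {subset l <= F} -> forall R, x \in R ->
    ((x, y) \in l) || ((y, x) \in l) -> y \in foldl grow R l.
  elim: l => //= s l IH sF R0 xR0; rewrite !inE.
  have xg : x \in grow R0 s.
    by rewrite /grow; case: ifP; rewrite // !inE xR0 !orbT.
  case: (boolP (((x, y) \in l) || ((y, x) \in l))) => [xyl _|nl].
    by apply: IH => // z zl; apply: sF; rewrite inE zl orbT.
  rewrite orbACA (negbTE nl) orbF => /orP[]/eqP <-; apply: grow_sub;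
    by rewrite /grow /= xR0 ?orbT !inE eqxx ?orbT.
exact: main.
Qed.

Lemma grow_path (l : seq (T * T)) R p s : p \in R -> path linkedb p s ->
  size s <= size l -> last p s \in foldl grow R (flatten [seq F | _ <- l]).
Proof.
elim: l R p s => [|e l IH] R p [|q s] //= pR.
  by move=> _ _; exact: grow_sub.
move=> /andP[pq qs] sl; rewrite foldl_cat.
by apply: IH => //; exact: grow_step pR pq.
Qed.

Lemma reachP p q :
  reflect (exists2 s, path linkedb p s & last p s = q) (q \in reach F p).
Proof.
apply: (iffP idP) => [|[s ps <-]].
  rewrite /reach; set l := flatten _.
  have lF : {subset l <= F} by move=> x /flattenP[_ /mapP[_ _ ->]].
  have main R : (forall x, x \in R -> exists2 s, path linkedb p s & last p s = x) ->
      forall x, x \in foldl grow R l -> exists2 s, path linkedb p s & last p s = x.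
    elim: l lF R => //= s l IH sF R HR.
    have sF' : s \in F by apply: sF; rewrite inE eqxx.
    apply: IH => [x xl|x]; first by apply: sF; rewrite inE xl orbT.
    have ext y z : linkedb y z -> (exists2 s, path linkedb p s & last p s = y) ->
        exists2 s, path linkedb p s & last p s = z.
      by move=> yz [t pt ty]; exists (rcons t z); rewrite ?rcons_path ?last_rcons ?pt ?ty.
    have s12 : linkedb s.1 s.2 by rewrite /linkedb -surjective_pairing sF'.
    have s21 : linkedb s.2 s.1 by rewrite /linkedb -surjective_pairing sF' orbT.
    rewrite /grow; case: ifP => [/orP[]/HR Hs|_]; last exact: HR.
      rewrite !inE => /or3P[/eqP->|/eqP->|/HR] //; exact: ext s12 Hs.
    by rewrite !inE => /or3P[/eqP->|/eqP->|/HR] //; exact: ext s21 Hs.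
  by apply: main => x; rewrite inE => /eqP->; exists [::].
case: (shortenP ps) => s' ps' us' _; apply: grow_path => //; first exact: mem_head.
have -> : size (F ++ F) = size (unzip1 F ++ unzip2 F).
  by rewrite !size_cat !size_map.
apply: uniq_leq_size; first by case/andP: us'.
have main x t : path linkedb x t -> {subset t <= unzip1 F ++ unzip2 F}.
  elim: t x => //= y t IH x /andP[xy /IH yt] z; rewrite inE => /predU1P[->|/yt //].
  rewrite mem_cat; case/orP: xy => [xy|yx].
    by apply/orP; right; apply/mapP; exists (x, y).
  by apply/orP; left; apply/mapP; exists (y, x).
exact: main ps'.
Qed.

End ReachCorrect.

(** The algorithm searches among rational points, whereas components are defined among real ones; an
    injective map of the nodes commutes with the search. *)
Lemma reach_map (T U : eqType) (f : T -> U) (F : seq (T * T)) p :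
  injective f -> reach [seq (f s.1, f s.2) | s <- F] (f p) = [seq f x | x <- reach F p].
Proof.
move=> fi; rewrite /reach.
have -> : flatten [seq [seq (f s.1, f s.2) | s <- F]
    | _ <- [seq (f s.1, f s.2) | s <- F] ++ [seq (f s.1, f s.2) | s <- F]] =
    [seq (f s.1, f s.2) | s <- flatten [seq F | _ <- F ++ F]].
  by rewrite map_flatten -map_comp -map_cat -map_comp.
rewrite -[[:: f p]]/(map f [:: p]); elim: (flatten _) [:: p] => //= s l IH R.
rewrite -IH; congr foldl.
by rewrite /grow /= !mem_map //; case: ifP.
Qed.

(** * Blocks of vertices and the edges between them *)

Section Windows.
Variable G : dks_instance.
Notation n := (dks_n G).
Notation k := (dks_k G).

Lemma pad_spec T : uniq T -> {subset T <= iota 0 n} -> size T <= k ->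
  [/\ uniq (pad G T), {subset pad G T <= iota 0 n}, size (pad G T) = k
    & {subset T <= pad G T}].
Proof.
move=> uT Tn Tk; rewrite /pad.
set U := T ++ _.
have uU : uniq U.
  rewrite cat_uniq uT filter_uniq ?iota_uniq // andbT /=.
  by apply/hasPn => x; rewrite mem_filter => /andP[].
have Un : U =i iota 0 n.
  move=> x; rewrite mem_cat mem_filter; case: (boolP (x \in T)) => //= /Tn -> //.
have sU : size U = n.
  by rewrite -[RHS](size_iota 0); apply/perm_size/uniq_perm => //; exact: iota_uniq.
split.
- exact: take_uniq.
- by move=> x /mem_take; rewrite Un.
- by rewrite size_takel // sU dks_k_le.
- by move=> x xT; rewrite take_cat ltnNge Tk /= mem_cat xT.
Qed.

Lemma candidate_spec V a b :
  [/\ uniq (candidate G V a b), {subset candidate G V a b <= iota 0 n},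
      size (candidate G V a b) = k &
      forall x, x < n -> (x \in window G V a) || (x \in window G V b) ->
        x \in candidate G V a b].
Proof.
have [|x||u s sz sb] := @pad_spec
  [seq i <- iota 0 n | (i \in window G V a) || (i \in window G V b)].
- by rewrite filter_uniq ?iota_uniq.
- by rewrite mem_filter => /andP[].
- apply: (@leq_trans (size (window G V a ++ window G V b))).
    apply: uniq_leq_size; first by rewrite filter_uniq ?iota_uniq.
    by move=> x; rewrite mem_filter mem_cat => /andP[].
  rewrite size_cat /window !size_take_min.
  have := geq_minl k./2 (size (drop a V)); have := geq_minl k./2 (size (drop b V)).
  lia.
split=> // x xn xw; apply: sb; by rewrite mem_filter xw mem_iota.
Qed.

Lemma densest_spec l :
  (forall T, T \in l -> exists V a b, T = candidate G V a b) ->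
  [/\ uniq (densest G l), {subset densest G l <= iota 0 n} & size (densest G l) = k].
Proof.
move=> H; have := mem_densest G l; rewrite inE => /predU1P[->|/H[V [a [b ->]]]].
  by have [] := @pad_spec [::].
by have [] := candidate_spec V a b.
Qed.

Lemma mem_window V a x : 0 < k./2 -> x \in V -> a = index x V %/ k./2 ->
  x \in window G V (a * k./2).
Proof.
move=> k0 xV ->; set i := index x V.
have iV : i < size V by rewrite index_mem.
have -> : x = nth x (window G V (i %/ k./2 * k./2)) (i %% k./2).
  by rewrite nth_take ?ltn_mod // nth_drop -divn_eq nth_index.
apply: mem_nth; rewrite size_take_min size_drop leq_min ltn_mod k0 /=.
by rewrite ltn_subRL -divn_eq.
Qed.

(* The vertices of [V] are cut into [r] blocks of at most [k/2] vertices, and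
   every edge within [V] lies in the union of two blocks. *)
Lemma nedges_blocks V l (r := (size V %/ k./2).+1) :
  0 < k./2 -> uniq V -> {subset V <= iota 0 n} -> {subset candidates G V <= l} ->
  nedges G V <= r * r * nedges G (densest G l).
Proof.
move=> k0 uV Vn Vl.
pose E (T : seq nat) : {set 'I_n * 'I_n} := [set p : 'I_n * 'I_n |
  [&& p.1 < p.2, adj G p.1 p.2, val p.1 \in T & val p.2 \in T]].
have EE T : nedges G T = #|E T| by rewrite /nedges size_pairs.
pose C (a b : 'I_r) := candidate G V (a * k./2) (b * k./2).
have sV : size V <= n by rewrite -[n](size_iota 0); exact: uniq_leq_size.
have Cl a b : nedges G (C a b) <= nedges G (densest G l).
  apply/nedges_densest/Vl/allpairsP.
  (* A block starts at a position at most [size V], hence at most [n]; equality can occur, which is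
     why position [n] is included. *)
  have le_n (c : 'I_r) : c * k./2 \in iota 0 n.+1.
    rewrite mem_iota ltnS; apply: leq_trans sV; apply: leq_trans (leq_divM (size V) k./2).
    by rewrite leq_mul2r -ltnS ltn_ord orbT.
  by exists (a * k./2, b * k./2); split; [exact: le_n|exact: le_n|].
apply: (@leq_trans (\sum_(a < r) \sum_(b < r) nedges G (C a b))); last first.
  apply: (@leq_trans (\sum_(a < r) \sum_(b < r) nedges G (densest G l))).
    by apply: leq_sum => a _; apply: leq_sum => b _.
  by rewrite !sum_nat_const !card_ord mulnA.
rewrite EE -sum1_card.
(* Double counting: every edge within [V] contributes at the pair of blocks of its ends, found by
   dividing their positions in [V] by [k/2]. *)
apply: (@leq_trans (\sum_(p in E V) \sum_(a < r) \sum_(b < r) (p \in E (C a b)))).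
  apply: leq_sum => p; rewrite inE => /and4P[lt12 adj12 p1 p2].
  have blk x : x \in V -> index x V %/ k./2 < r.
    by move=> xV; rewrite ltnS leq_div2r // ltnW // index_mem.
  rewrite (bigD1 (Ordinal (blk _ p1))) //= (bigD1 (Ordinal (blk _ p2))) //=.
  rewrite inE lt12 adj12 /=.
  have [_ _ _ sb] := candidate_spec V (index (val p.1) V %/ k./2 * k./2)
    (index (val p.2) V %/ k./2 * k./2).
  have -> : val p.1 \in C (Ordinal (blk _ p1)) (Ordinal (blk _ p2)).
    by apply: sb; [exact: ltn_ord|rewrite mem_window].
  have -> // : val p.2 \in C (Ordinal (blk _ p1)) (Ordinal (blk _ p2)).
  by apply: sb; [exact: ltn_ord|rewrite (mem_window k0 p2 erefl) orbT].
rewrite exchange_big; apply: leq_sum => a _; rewrite exchange_big; apply: leq_sum => b _.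
rewrite EE -sum1_card big_mkcond [X in _ <= X]big_mkcond.
by apply: leq_sum => p _; case: (p \in E V); case: (p \in E (C a b)).
Qed.

End Windows.

(** * Lengths of forests *)

Local Open Scope ring_scope.

Section Lengths.
Context {R : realType} {m : nat}.
Implicit Types (p q x y : 'rV[R]_m) (F : seq ('rV[R]_m * 'rV[R]_m)).

Lemma euclidean_dist_ge0 p q : 0 <= euclidean_dist p q.
Proof. exact: sqrtr_ge0. Qed.

(** The norm of a row vector is the maximum norm. Separation of the grid points and the potentials
    are measured in it, and this inequality returns to Euclidean length. *)
Lemma norm_le_euclidean p q : `|p - q| <= euclidean_dist p q.
Proof.
have [->|/mx_norm_neq0[[i j] E]] := eqVneq `|p - q| 0; first exact: euclidean_dist_ge0.
rewrite [X in X <= _]E /= !mxE ord1 -sqrtr_sqr; apply: ler_wsqrtr.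
rewrite (bigD1 j) //= lerDl; apply: sumr_ge0 => k _; exact: sqr_ge0.
Qed.

Lemma coord_le_norm x i : `|x ord0 i| <= `|x|.
Proof.
rewrite [X in _ <= X]mx_normrE.
exact: (le_bigmax_cond _ (fun i : 'I_1 * 'I_m => `|x i.1 i.2|) (j := (ord0, i))).
Qed.

Lemma euclidean_dist_le p q (b : R) : (forall i, `|p ord0 i - q ord0 i| <= b) ->
  0 <= b -> euclidean_dist p q <= m%:R * b.
Proof.
move=> H b0; have mb0 : 0 <= m%:R * b by rewrite mulr_ge0.
rewrite -[X in _ <= X](ger0_norm mb0) -sqrtr_sqr; apply: ler_wsqrtr.
apply: (@le_trans _ _ (\sum_(i < m) b ^+ 2)).
  apply: ler_sum => i _; rewrite -real_normK ?num_real //.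
  by rewrite lerXn2r ?nnegrE.
rewrite sumr_const card_ord -[b ^+ 2 *+ m]mulr_natl exprMn ler_wpM2r ?sqr_ge0 //.
by rewrite -natrX ler_nat; case: (m) => // k; rewrite expnS leq_pmulr ?expn_gt0.
Qed.

Lemma total_length_ge0 F : 0 <= total_length F.
Proof. by apply: sumr_ge0 => s _; exact: euclidean_dist_ge0. Qed.

(** A tent over the ball of radius 1/2. A path from [p] to any point at distance at least 1 must
    bring it down from 1/2 to 0. *)
Definition bump p x : R := Num.max 0 (2^-1 - `|x - p|).

Lemma bump_ge0 p x : 0 <= bump p x.
Proof. by rewrite le_max lexx. Qed.

Lemma bump_self p : bump p p = 2^-1.
Proof. by rewrite /bump subrr normr0 subr0 max_r // invr_ge0. Qed.

Lemma bump_far p x : 1 <= `|x - p| -> bump p x = 0.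
Proof. by move=> xp; rewrite /bump max_l // subr_le0; lra. Qed.

Lemma bump_gt0 p x : (0 < bump p x) = (`|x - p| < 2^-1).
Proof. by rewrite /bump lt_max ltxx subr_gt0. Qed.

Lemma bump_gt0E p x : 0 < bump p x -> bump p x = 2^-1 - `|x - p|.
Proof. by rewrite bump_gt0 => H; rewrite /bump max_r // subr_ge0 ltW. Qed.

Lemma bump_eq0 p x : (0 < bump p x) = false -> bump p x = 0.
Proof. by move=> /negbT; rewrite -leNgt => H; apply/le_anti; rewrite H bump_ge0. Qed.

Lemma bump_lipschitz p x y : `|bump p x - bump p y| <= `|x - y|.
Proof.
have /andP[A B] : - `|x - y| <= `|x - p| - `|y - p| <= `|x - y|.
  rewrite -ler_norml; apply: le_trans (ler_dist_dist _ _) _.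
  by rewrite opprB addrA subrK.
rewrite ler_norml /bump; case: (leP 0 (2^-1 - `|x - p|)) => H1;
  case: (leP 0 (2^-1 - `|y - p|)) => H2; apply/andP; split; lra.
Qed.

Section Bumps.
Variables (I : finType) (P : I -> 'rV[R]_m).
Hypothesis P_sep : forall i j, i != j -> 1 <= `|P i - P j|.

Lemma bump_unique x i j : 0 < bump (P i) x -> 0 < bump (P j) x -> i = j.
Proof.
rewrite !bump_gt0 => xi xj; apply/eqP/negPn/negP => /P_sep.
have : `|P i - P j| <= `|x - P i| + `|x - P j|.
  rewrite [`|x - P i|]distrC; apply: le_trans (ler_normD _ _).
  by rewrite addrA subrK.
lra.
Qed.

(* The bumps have disjoint supports; if [x] and [y] are in different supports,
   their distance is at least the sum of the two heights. *)
Lemma sum_bump_le x y : \sum_i `|bump (P i) x - bump (P i) y| <= `|x - y|.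
Proof.
case: (pickP (fun i => 0 < bump (P i) x)) => [i xi|x0]; last first.
  case: (pickP (fun i => 0 < bump (P i) y)) => [j yj|y0].
    rewrite (bigD1 j) //= big1 ?addr0 ?bump_lipschitz // => k kj.
    rewrite (bump_eq0 (x0 k)) bump_eq0 ?subrr ?normr0 //.
    by apply/negbTE/negP => /(bump_unique yj) jk; rewrite jk eqxx in kj.
  rewrite big1 // => k _; by rewrite (bump_eq0 (x0 k)) (bump_eq0 (y0 k)) subrr normr0.
have xk k : k != i -> bump (P k) x = 0.
  by move=> ki; apply/bump_eq0/negbTE/negP => /(bump_unique xi) ik; rewrite ik eqxx in ki.
case: (pickP (fun j => (j != i) && (0 < bump (P j) y))) => [j /andP[ji yj]|y0]; last first.
  rewrite (bigD1 i) //= big1 ?addr0 ?bump_lipschitz // => k ki.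
  rewrite xk // bump_eq0 ?subrr ?normr0 //.
  by have := y0 k; rewrite ki.
have yk k : k != j -> bump (P k) y = 0.
  by move=> kj; apply/bump_eq0/negbTE/negP => /(bump_unique yj) jk; rewrite jk eqxx in kj.
rewrite (bigD1 i) //= (bigD1 j) //= big1 => [|k /andP[ki kj]]; last first.
  by rewrite xk // yk // subrr normr0.
rewrite addr0 (yk i) 1?eq_sym // (xk j) // subr0 sub0r normrN !ger0_norm ?bump_ge0 //.
rewrite (bump_gt0E xi) (bump_gt0E yj); have := P_sep ji.
(* The left side is at least 1, that is, one 1/2 for each of the two tents; rearranging gives the
   sum of the two heights. *)
have : `|P j - P i| <= `|y - P j| + (`|x - y| + `|x - P i|).
  rewrite [`|y - P j|]distrC [`|x - y|]distrC.
  apply: le_trans (lerD (lexx _) (ler_normD _ _)).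
  apply: le_trans (ler_normD _ _).
  by rewrite !addrA !subrK.
lra.
Qed.

End Bumps.

(** A simple path uses no segment twice. In the induction, the segments at the first node [p] pay
    for the first step, and the rest of the path avoids [p], so it lives on the segments selected by
    [off]. *)
Lemma path_variation (T : eqType) (F : seq (T * T)) (phi : T -> R) (p : T) s :
  path (linkedb F) p s -> uniq (p :: s) ->
  `|phi p - phi (last p s)| <= \sum_(e <- F) `|phi e.1 - phi e.2|.
Proof.
elim: s F p => [|q s IH] F p /=.
  by move=> _ _; rewrite subrr normr0; apply: sumr_ge0 => e _; exact: normr_ge0.
move=> /andP[pq qs] /and3P[]; rewrite inE negb_or => /andP[npq nps] nqs us.
pose off (e : T * T) := (e.1 != p) && (e.2 != p).
have qs' : path (linkedb [seq e <- F | off e]) q s.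
  have : all (predC1 p) (q :: s).
    by apply/allP => x; rewrite inE => /predU1P[->|xs] /=; [rewrite eq_sym|apply: contraNneq nps => <-].
  elim: s q qs {IH pq npq nps nqs us} => //= r s IH q /andP[qr rs] /and3P[qp rp sp].
  rewrite IH ?rp //= andbT; move: qr; rewrite /linkedb !mem_filter /off /=.
  by rewrite qp rp.
have := IH [seq e <- F | off e] q qs'; rewrite /= nqs us => /(_ isT) H.
rewrite (bigID off) /=; rewrite big_filter in H.
have pq1 : `|phi p - phi q| <= \sum_(e <- F | ~~ off e) `|phi e.1 - phi e.2|.
  have main e : e \in F -> ~~ off e -> `|phi e.1 - phi e.2| <=
      \sum_(e <- F | ~~ off e) `|phi e.1 - phi e.2|.
    move=> eF oe; rewrite (big_rem _ eF) /= oe lerDl.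
    by apply: sumr_ge0 => e' _; exact: normr_ge0.
  case/orP: pq => [pq|qp].
    by apply: (main (p, q)) => //; rewrite /off eqxx.
  by rewrite distrC; apply: (main (q, p)) => //; rewrite /off eqxx andbF.
have -> : phi p - phi (last q s) = (phi p - phi q) + (phi q - phi (last q s)).
  by rewrite addrA subrK.
apply: le_trans (ler_normD _ _) _; rewrite addrC; exact: lerD.
Qed.

Lemma same_component_sym F p q : same_component F p q -> same_component F q p.
Proof.
move=> [s ps <-]; exists (rev (belast p s)); last by case: s {ps} => //= x s; rewrite rev_cons last_rcons.
by rewrite rev_path; apply: sub_path ps => x y; rewrite /Defs.adjacent orbC.
Qed.

(** Along its own path each vertex of [V] collects a variation of 1/2 of its bump. After exchanging
    the sums, the variations of all bumps over one segment are paid by its length, even where paths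
    overlap. *)
Lemma total_length_ge (I : finType) (P : I -> 'rV[R]_m) (V : {set I}) F :
  (forall i j, i != j -> 1 <= `|P i - P j|) ->
  (forall i, i \in V -> exists2 j, j != i & same_component F (P i) (P j)) ->
  #|V|%:R / 2 <= total_length F.
Proof.
move=> sep comp.
have -> : #|V|%:R / 2 = \sum_(i in V) (2^-1 : R).
  by rewrite sumr_const mulr_natl.
apply: (@le_trans _ _ (\sum_(i in V) \sum_(e <- F) `|bump (P i) e.1 - bump (P i) e.2|)).
  apply: ler_sum => i /comp[j ji [s ps ls]].
  case: (shortenP ps) ls => s' ps' us' _ ls.
  have := path_variation (bump (P i)) ps' us'; rewrite ls bump_self bump_far ?sep //.
  by rewrite subr0 ger0_norm // invr_ge0.
rewrite exchange_big; apply: ler_sum => e _ /=.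
apply: le_trans (norm_le_euclidean _ _); apply: le_trans (sum_bump_le sep _ _).
rewrite [X in _ <= X](bigID [in V]) /= lerDl; apply: sumr_ge0 => i _; exact: normr_ge0.
Qed.

(** * Stars as cheap forests *)

Section Star.
Variables (c : 'rV[R]_m) (L : seq 'rV[R]_m).
Hypotheses (uL : uniq L) (cL : c \notin L).

Definition star := [seq (c, x) | x <- L].

Lemma adjacent_star x y :
  Defs.adjacent star x y -> [/\ x == c & y != c] \/ [/\ y == c & x != c].
Proof.
by case/orP => /mapP[z zL [-> ->]]; [left|right]; split => //;
   apply: contraNneq cL => <-.
Qed.

(** Every segment has exactly one end at [c], so [c] would be every other node of a cycle, whereas
    the nodes of a cycle are distinct. *)
Lemma is_forest_star : is_forest star.
Proof.
split.
- by rewrite map_inj_uniq // => x y [].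
- move=> p q /mapP[x xL [-> ->]]; apply/negP => /mapP[y yL [xc cy]].
  by move: cL; rewrite -xc xL.
move=> [|x [|y [|z s]]] // /andP[/= /and3P[xy yz zs]].
rewrite !inE !negb_or => /and3P[/and3P[nxy nxz nxs] /andP[nyz nys] _].
(* The node after [z] on the cycle, which is [x] itself when the cycle has length 3. *)
have [w [zw nwy]] : exists w, Defs.adjacent star z w /\ y != w.
  move: zs; case: s nxs nys => [|w s] /=.
    by move=> _ _ /andP[zx _]; exists x; rewrite eq_sym.
  by move=> _; rewrite inE negb_or => /andP[yw _] /andP[zw _]; exists w.
have Axy := adjacent_star xy; have Ayz := adjacent_star yz; have Azw := adjacent_star zw.
case: Axy => [[/eqP xc ync]|[/eqP yc xnc]].
  case: Ayz => [[yc _]|[/eqP zc _]]; first by rewrite yc in ync.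
  by rewrite xc zc eqxx in nxz.
case: Azw => [[/eqP zc _]|[/eqP wc _]]; first by rewrite yc zc eqxx in nyz.
by rewrite yc wc eqxx in nwy.
Qed.

Lemma same_component_star x y : x \in c :: L -> y \in c :: L ->
  same_component star x y.
Proof.
have cx z : z \in L -> Defs.adjacent star c z /\ Defs.adjacent star z c.
  by move=> zL; rewrite /Defs.adjacent !(map_f (pair c)) // orbT.
rewrite !inE => /predU1P[->|/cx[cx' xc]] /predU1P[->|/cx[cy yc]].
- by exists [::].
- by exists [:: y]; rewrite //= cy.
- by exists [:: c]; rewrite //= xc.
- by exists [:: c; y]; rewrite //= xc cy.
Qed.

Lemma total_length_star (b : R) : (forall x, x \in L -> euclidean_dist c x <= b) ->
  total_length star <= (size L)%:R * b.
Proof.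
move=> H; rewrite /total_length big_map /=; elim: L H => [|x l IH] H.
  by rewrite big_nil mul0r.
rewrite big_cons /= -natr1 mulrDl mul1r addrC; apply: lerD; last by rewrite H ?mem_head.
by apply: IH => y yl; rewrite H // inE yl orbT.
Qed.

End Star.

End Lengths.

(** * Analysis of the reduction *)

Lemma real_point_inj (R : realType) D : injective (@real_point R D).
Proof. by apply: map_mx_inj; exact: fmorph_inj. Qed.

(** The values below the threshold are absorbed into the constant, since [n^e >= 1] for positive [n]
    when the exponent is nonnegative. *)
Lemma bigO_le (R : realType) (f : nat -> R) (e : R) : 0 <= e ->
  (f =O_\oo (fun n => n%:R `^ e)%R)%classic ->
  exists2 C : R, 0 <= C & forall n, (0 < n)%N -> f n <= C * n%:R `^ e.
Proof.
move=> e0 /eqO_exP[k k0 [N _ H]].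
exists (k + \sum_(i < N) `|f i|); first by rewrite addr_ge0 ?sumr_ge0 // ltW.
move=> n n0; have n1 : 1 <= n%:R `^ e by rewrite -[X in X <= _](powRr0 n%:R) ler_powR // ler1n.
have s0 : 0 <= \sum_(i < N) `|f i| by apply: sumr_ge0.
apply: le_trans (ler_norm _) _; case: (ltnP n N) => [nN|/H /=].
  have fn : `|f n| <= \sum_(i < N) `|f i|.
    by rewrite (bigD1 (Ordinal nN)) //= lerDl sumr_ge0.
  apply: le_trans fn _; rewrite -[X in X <= _]mulr1.
  by apply: ler_pM => //; rewrite lerDr ltW.
rewrite [`|n%:R `^ e|]ger0_norm ?powR_ge0 // => /le_trans; apply.
by rewrite ler_wpM2r ?powR_ge0 // lerDl.
Qed.

Section Analysis.
Context {R : realType} {D : nat} (D_gt0 : (0 < D)%N).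
Variables (f : nat -> R) (K : kforest_instance D -> seq ('rV[rat]_D * 'rV[rat]_D)).
Hypothesis K_approx : forall X, kforest_approx f X (K X).

Section Instance.
Variable G : dks_instance.
Notation n := (dks_n G).
Let P (i : 'I_n) : 'rV[R]_D := real_point (point D n i).

Lemma grid_point_sep i j : i != j -> 1 <= `|P i - P j|.
Proof.
move=> ij.
have [c ne] : exists c : 'I_D, coord D n i c != coord D n j c.
  apply/existsP; rewrite -negb_forall; apply: contra ij => /forallP H.
  apply/eqP/val_inj/(coord_inj D_gt0 (ltn_ord i) (ltn_ord j)) => c cD.
  exact/eqP/(H (Ordinal cD)).
apply: le_trans (coord_le_norm _ c); rewrite !mxE !ratr_nat.
by case: (ltngtP (coord D n i c) (coord D n j c)) ne => // lt _;
   [rewrite distrC|]; rewrite -natrB ?(ltnW lt) // ger0_norm // ler1n subn_gt0.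
Qed.

Lemma grid_point_dist i j :
  euclidean_dist (P i) (P j) <= D%:R * n%:R `^ (D%:R^-1).
Proof.
apply: euclidean_dist_le; last exact: powR_ge0.
move=> c; rewrite !mxE !ratr_nat.
have := coord_ltn D_gt0 (ltn_ord i) (ltn_ord c).
have := coord_ltn D_gt0 (ltn_ord j) (ltn_ord c).
set a := coord D n i c; set b := coord D n j c => bs as_.
have small x : (x < side D n)%N -> x%:R <= n%:R `^ (D%:R^-1) :> R.
  move=> /(side_spec n D_gt0).2 xn.
  have -> : x%:R = ((x ^ D)%:R : R) `^ (D%:R^-1).
    rewrite natrX -powR_mulrn // -powRrM divff ?powRr1 //.
    by rewrite pnatr_eq0 -lt0n.
  by apply: ge0_ler_powR; rewrite ?nnegrE ?invr_ge0 // ler_nat ltnW.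
rewrite ler_norml; have := small _ bs; have := small _ as_.
have := ler0n R a; have := ler0n R b; lra.
Qed.

Lemma linkedP l (i : 'I_n) (F := K (to_kforest D_gt0 G l)) :
  reflect (exists2 j : 'I_n, dks_adj i j & same_component (real_segments F) (P i) (P j))
    (val i \in linked G F).
Proof.
rewrite mem_filter mem_iota ltn_ord !andbT.
have reachE (j : 'I_n) : (point D n j \in reach F (point D n i)) =
    (P j \in reach (real_segments F) (P i)).
  rewrite /P /real_segments (reach_map _ _ (@real_point_inj R D)) mem_map //.
  exact: real_point_inj.
apply: (iffP hasP) => [[j]|[j aj /reachP cj]].
  rewrite mem_iota => /= jn /andP[aj cj]; exists (Ordinal jn).
    by rewrite -adjE.
  by apply/reachP; rewrite -reachE.
by exists (val j); rewrite ?mem_iota ?ltn_ord // adjE aj reachE.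
Qed.

Lemma uniq_linked F : uniq (linked (D := D) G F).
Proof. by rewrite filter_uniq ?iota_uniq. Qed.

Lemma linked_sub F : {subset linked (D := D) G F <= iota 0 n}.
Proof. by move=> x; rewrite mem_filter => /andP[]. Qed.

Lemma size_card (V : seq nat) : uniq V -> {subset V <= iota 0 n} ->
  size V = #|[set i : 'I_n | val i \in V]|.
Proof.
move=> uV Vn; rewrite cardE -(size_map val); apply/perm_size/uniq_perm => //.
  by rewrite map_inj_uniq ?enum_uniq //; exact: val_inj.
move=> x; apply/idP/mapP => [xV|[i + ->]]; last by rewrite mem_enum inE.
have := Vn x xV; rewrite mem_iota => /= xn.
by exists (Ordinal xn); rewrite // mem_enum inE.
Qed.

Lemma size_linked_le l (F := K (to_kforest D_gt0 G l)) :
  (size (linked G F))%:R / 2 <= total_length (real_segments F) :> R.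
Proof.
rewrite (size_card (uniq_linked F) (@linked_sub F)).
apply: (@total_length_ge _ _ _ P) => [i j|i]; first exact: grid_point_sep.
rewrite inE => /linkedP[j aj cj]; exists j => //.
by apply: contraTneq aj => ->; rewrite dks_adj_irr.
Qed.

Section Optimum.
Variable T : {set 'I_n}.
Hypothesis cardT : #|T| = dks_k G.
Let l := induced_edges T.
Hypothesis l_gt0 : (0 < l)%N.
Let F := K (to_kforest D_gt0 G l).

Lemma induced_edgesE : l = #|[set p in demands G | (p.1 \in T) && (p.2 \in T)]|.
Proof.
apply: eq_card => p; rewrite !inE; apply/asboolP/idP => /=.
  by case/and4P=> -> -> -> ->.
by case/andP=> /andP[-> ->] /andP[-> ->].
Qed.

Lemma l_le : (l <= #|demands G|)%N.
Proof.
by rewrite induced_edgesE; apply/subset_leq_card/fintype.subsetP => p; rewrite inE => /andP[].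
Qed.

Lemma kf_kE : kf_k (to_kforest D_gt0 G l) = l.
Proof. by rewrite /= l_le. Qed.

(** A satisfied demand is an edge whose ends are joined by the forest, so each end is linked because
    of the other. *)
Lemma nedges_linked : (l <= nedges G (linked G F))%N.
Proof.
have [[_ +] _] := K_approx (to_kforest D_gt0 G l).
rewrite kf_kE => /leq_trans; apply; rewrite /nedges size_pairs.
apply/subset_leq_card/fintype.subsetP => p; rewrite !inE.
move=> /andP[/andP[lt12 a12]] /asboolP c12.
rewrite lt12 adjE a12 /=; apply/andP; split; apply/linkedP.
  by exists p.2.
exists p.1; first by rewrite dks_adj_sym.
exact: same_component_sym.
Qed.

(** The two ends of an edge lie in [T]. It follows that blocks of [k/2] vertices are not empty. *)
Lemma k_gt1 : (1 < dks_k G)%N.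
Proof.
move: l_gt0; rewrite induced_edgesE => /card_gt0P[p].
rewrite !inE => /andP[/andP[lt12 _] /andP[p1 p2]].
rewrite -cardT; apply: (@leq_trans #|[set p.1; p.2]|).
  by rewrite cards2 neq_ltn lt12.
by apply/subset_leq_card/fintype.subsetP => x; rewrite !inE => /orP[]/eqP->.
Qed.

Lemma optimum_le (b := D%:R * n%:R `^ (D%:R^-1)) :
  exists2 F' : seq ('rV[R]_D * 'rV[R]_D),
    kforest_feasible (to_kforest D_gt0 G l) F' & total_length F' <= (dks_k G)%:R * b.
Proof.
have [i0 i0T] : exists i, i \in T.
  by apply/card_gt0P; rewrite cardT; exact: ltnW k_gt1.
have P_inj : injective P.
  by move=> i j /real_point_inj; exact: point_inj.
pose L := [seq P i | i <- enum (T :\ i0)].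
have uL : uniq L by rewrite map_inj_uniq ?enum_uniq.
have i0L : P i0 \notin L by rewrite mem_map // mem_enum !inE eqxx.
have mem_star i : i \in T -> P i \in P i0 :: L.
  move=> iT; rewrite inE; case: eqP => //= ne; rewrite mem_map // mem_enum !inE iT andbT.
  by apply/eqP => ii; apply: ne; rewrite ii.
exists (star (P i0) L).
  split; first exact: is_forest_star.
  rewrite kf_kE induced_edgesE.
  apply/subset_leq_card/fintype.subsetP => p; rewrite !inE => /andP[/andP[-> ->] /andP[p1 p2]] /=.
  by apply/asboolP; apply: same_component_star; exact: mem_star.
apply: (@le_trans _ _ ((size L)%:R * b)).
  by apply: total_length_star => x /mapP[i _ ->]; exact: grid_point_dist.
apply: ler_wpM2r; first by rewrite mulr_ge0 ?powR_ge0.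
by rewrite ler_nat size_map -cardE -cardT subset_leq_card // subsetDl.
Qed.

End Optimum.

End Instance.

End Analysis.

(** * The approximation ratio *)

Section Ratio.
Context {R : realType} {D : nat} (D_gt0 : (0 < D)%N).
Variables (f : nat -> R) (K : kforest_instance D -> seq ('rV[rat]_D * 'rV[rat]_D)).
Hypothesis K_approx : forall X, kforest_approx f X (K X).
Variables (C e d : R).
Hypothesis C_ge0 : 0 <= C.
Hypothesis f_le : forall n, (0 < n)%N -> f n <= C * n%:R `^ e.
Hypothesis exponent_le : e + D%:R^-1 <= 1 / (2 * d).
Hypothesis d_gt0 : 0 < d.

(** The linked vertices number at most [2 C D k n^(1/(2d))]. Passing to blocks of [k/2] multiplies
    the bound by [3/k], rounding adds 1, which is at most [n^(1/(2d))], and pairs of blocks give the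
    square. *)
Definition ratio : R := (6 * (C * D%:R) + 1) ^+ 2.

Lemma dks_solution_ratio (G : dks_instance) (T : {set 'I_(dks_n G)}) :
  #|T| = dks_k G ->
  (induced_edges T)%:R <=
    ratio * (dks_n G)%:R `^ (1 / d) * (nedges G (dks_solution D_gt0 K G))%:R.
Proof.
move=> cardT.
(* Without edges in [T] there is nothing to prove; with one, [k] is at least 2. *)
have [->|l_gt0] := posnP (induced_edges T).
  rewrite mulr0n; apply: mulr_ge0 => //; apply: mulr_ge0; last exact: powR_ge0.
  exact: sqr_ge0.
set l := induced_edges T in l_gt0 *.
set n := dks_n G; set k := dks_k G.
have k1 : (1 < k)%N := k_gt1 cardT l_gt0.
have n0 : (0 < n)%N by apply: leq_trans (dks_k_le G); exact: ltnW.
have n1 : 1 <= n%:R :> R by rewrite ler1n.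
set F := K (to_kforest D_gt0 G l); set V := linked G F.
set be : R := n%:R `^ (1 / (2 * d)).
have be1 : 1 <= be.
  by rewrite -[X in X <= _](powRr0 n%:R) ler_powR // divr_ge0 // mulr_ge0 // ltW.
have V_le : (size V)%:R <= 2 * (C * D%:R) * be * k%:R :> R.
  have [F' feas lenF'] := @optimum_le R D D_gt0 G T cardT l_gt0.
  have := (K_approx (to_kforest D_gt0 G l)).2 F' feas.
  rewrite -/F /= -/n => lenF.
  have := size_linked_le (R := R) D_gt0 K G l; rewrite -/F -/V => lenV.
  have len0 := total_length_ge0 F'.
  have fF' : f n * total_length F' <= C * n%:R `^ e * (k%:R * (D%:R * n%:R `^ (D%:R^-1))).
    apply: le_trans (ler_wpM2r len0 (f_le n0)) _.
    by apply: ler_wpM2l lenF'; rewrite mulr_ge0 ?powR_ge0.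
  (* The loss of the forest algorithm and the side of the grid together stay within [n^(1/(2d))]. *)
  have ee : n%:R `^ e * n%:R `^ (D%:R^-1) <= be.
    rewrite -powRD; first exact: ler_powR.
    by apply/implyP => _; rewrite pnatr_eq0 -lt0n.
  have CDk : 0 <= C * D%:R * k%:R by rewrite !mulr_ge0.
  have := ler_wpM2l CDk ee.
  have -> : C * D%:R * k%:R * (n%:R `^ e * n%:R `^ D%:R^-1) =
     C * n%:R `^ e * (k%:R * (D%:R * n%:R `^ (D%:R^-1))) by ring.
  move=> /(le_trans fF')/(le_trans lenF)/(le_trans lenV).
  rewrite ler_pdivrMr // => /le_trans; apply.
  by rewrite le_eqVlt; apply/orP; left; apply/eqP; ring.
have h0 : (0 < k./2)%N by lia.
set r := (size V %/ k./2).+1.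
have l_le_r : (l <= r * r * nedges G (dks_solution D_gt0 K G))%N.
  apply: leq_trans (@nedges_linked R D D_gt0 f K K_approx G T) _.
  apply: nedges_blocks => //; [exact: uniq_linked|exact: linked_sub|].
  move=> W Wc; apply/flattenP; exists (candidates G V) => //.
  apply/mapP; exists l => //; rewrite mem_iota ltnS size_edges.
  exact: l_le.
have r_le : r%:R <= (6 * (C * D%:R) + 1) * be.
  (* For [k >= 2], [k] is at most three times [k/2] rounded down, with equality at [k = 3]. *)
  have q_le : (size V %/ k./2 * k <= 3 * size V)%N.
    by have := leq_divM (size V) k./2; nia.
  have : (size V %/ k./2)%:R * k%:R <= 3 * (2 * (C * D%:R) * be * k%:R) :> R.
    rewrite -natrM; apply: le_trans (_ : (3 * size V)%:R <= _); first by rewrite ler_nat.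
    by rewrite natrM ler_wpM2l.
  have k0 : 0 < k%:R :> R by rewrite ltr0n ltnW.
  have -> : 3 * (2 * (C * D%:R) * be * k%:R) = (6 * (C * D%:R) * be) * k%:R by ring.
  rewrite ler_pM2r // => H; rewrite /r mulrS addrC.
  by rewrite [X in _ <= X]mulrDl mul1r lerD.
have bb : be ^+ 2 = n%:R `^ (1 / d).
  rewrite -powR_mulrn ?powR_ge0 // /be -powRrM; congr (_ `^ _).
  by field; rewrite gt_eqF.
apply: (@le_trans _ _ ((r * r * nedges G (dks_solution D_gt0 K G))%:R)).
  by rewrite ler_nat.
rewrite natrM ler_wpM2r // natrM -expr2 /ratio -bb -exprMn.
by rewrite lerXn2r ?nnegrE // mulr_ge0 ?addr_ge0 ?mulr_ge0 // (le_trans _ be1).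
Qed.

Lemma dks_solution_spec (G : dks_instance) (S := dks_solution D_gt0 K G) :
  [/\ uniq S, {subset S <= iota 0 (dks_n G)} & size S = dks_k G].
Proof.
apply: densest_spec => T /flattenP[_ /mapP[l _ ->] /allpairsP[[a b] [_ _ ->]]].
by exists (linked G (K (to_kforest D_gt0 G l))), a, b.
Qed.

Definition dks_set (G : dks_instance) : {set 'I_(dks_n G)} :=
  [set i : 'I_(dks_n G) | val i \in dks_solution D_gt0 K G].

Lemma dks_set_approx G : dks_approx (fun n => ratio * n%:R `^ (1 / d)) (dks_set G).
Proof.
have [uS Sn sS] := dks_solution_spec G.
split; first by rewrite -size_card.
by move=> T cardT; rewrite -nedgesE; exact: dks_solution_ratio.
Qed.

Lemma encode_dks_mask G : encode (dks_mask D_gt0 K G) = enc_set (dks_set G).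
Proof.
rewrite /dks_mask -val_enum_ord -map_comp /enc_set; congr (enc_seq _ _).
by apply: eq_map => i; rewrite /= inE.
Qed.

End Ratio.

Theorem theorem7 (R : realType) (d : R) (d_gt0 : 0 < d)
  (dks_hard : within_bigO (@dks_hard_within R) (fun n => n%:R `^ (1 / d)))
  (d' : nat) (d'_gt : 2 * d + 1 < d'%:R) :
  within_bigO (@kforest_hard_within R d')
    (fun n => n%:R `^ (1 / (2 * d) - 1 / (d'%:R - 1))).
Proof.
move=> f f_O [c c_solves].
have [K PK K_approx] := poly_time_solvesP (eI := @encodable_kforest d')
  (eO := encodable_seq (encodable_prod (@encodable_rV d') (@encodable_rV d'))) c_solves.
have D1 : 1 < d'%:R :> R by lra.
have D_gt0 : (0 < d')%N by rewrite -(ltr0n R); lra.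
set e := 1 / (2 * d) - 1 / (d'%:R - 1) in f_O.
(* The assumption on the dimension says that [2 d < d' - 1]. *)
have e_ge0 : 0 <= e.
  by rewrite subr_ge0 !div1r lef_pV2 ?posrE; lra.
have [C C_ge0 f_le] := bigO_le e_ge0 f_O.
(* As [1/d' <= 1/(d'-1)], the exponent leaves room for the side of the grid. *)
have exponent_le : e + d'%:R^-1 <= 1 / (2 * d).
  rewrite /e -addrA gerDl addrC subr_le0 div1r lef_pV2 ?posrE; lra.
pose phi (n : nat) : R := ratio (D := d') C * n%:R `^ (1 / d).
apply: (dks_hard phi).
  apply/eqO_exP; exists (ratio (D := d') C).
    by rewrite exprn_gt0 // ltr_wpDl // !mulr_ge0.
  by apply: nearW => n; rewrite /phi normrM [`|ratio C|]ger0_norm ?sqr_ge0.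
have [c' [m [time [[a [b time_le]] H]]]] := poly_time_dks_mask D_gt0 PK.
exists c', a, b => G; exists (dks_set D_gt0 K G).
have [s' [t [E O T _]]] := H G (update (fun=> Leaf) 0 (enc_dks G)) erefl.
exists t; split.
- by exists s' => //; rewrite O; exact: encode_dks_mask.
- exact: leq_trans T (time_le G).
- exact: (dks_set_approx D_gt0 K_approx C_ge0 f_le exponent_le d_gt0).
Qed.
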